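(* Suppose $\mathcal{U}_1$ is Ramsey for $\mathcal{R}_1$ (with the standing canonization assumption below) and $\mathcal{V}$ is a nonprincipal ultrafilter with $\mathcal{U}_1\ge_T\mathcal{V}$. Then $\mathcal{V}$ is isomorphic to an ultrafilter of $\vec{\mathcal{W}}$-trees: there are a countable set $\mathcal{S}$ of finite sequences, no member of which is a proper initial segment of another, such that the tree $\hat{\mathcal{S}}$ of all initial segments of members of $\mathcal{S}$ (ordered by end-extension) is well-founded (has no infinite branch), and for each $s\in\hat{\mathcal{S}}\setminus\mathcal{S}$ an ultrafilter $\mathcal{W}_s$ on the set of immediate successors of $s$ in $\hat{\mathcal{S}}$ which (under the natural identification of these successors with the base set) is exactly one of the ultrafilters $\mathcal{Y}_n$, $n<\omega$; and $\mathcal{V}$ is isomorphic to the ultrafilter on $\mathcal{S}$ generated by the sets $\hat{S}\cap\mathcal{S}$ where $\hat{S}\subseteq\hat{\mathcal{S}}$ ranges over $\vec{\mathcal{W}}$-trees, i.e. subtrees closed under initial segments, containing the root, such that for every $s\in\hat{S}\setminus\mathcal{S}$ the set of immediate successors of $s$ in $\hat{S}$ belongs to $\mathcal{W}_s$.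
   Context: Let $\mathbb{T}=\{\langle\rangle\}\cup\{\langle n\rangle:n<\omega\}\cup\{\langle n,i\rangle:n<\omega,\ i\le n\}$. $X\subseteq\mathbb{T}$ is in $\mathcal{R}_1$ iff there are strictly increasing $(k_n)$ and $L_n\subseteq\{0,\dots,k_n\}$ with $|L_n|=n+1$ such that $X=\{\langle\rangle\}\cup\bigcup_n(\{\langle k_n\rangle\}\cup\{\langle k_n,i\rangle:i\in L_n\})$; $X(n)=\{\langle\rangle,\langle k_n\rangle,\langle k_n,i\rangle:i\in L_n\}$, $r_n(X)=\bigcup_{i<n}X(i)$, $\mathcal{AR}=\{r_n(X):X\in\mathcal{R}_1,n<\omega\}$, $Y\le X$ iff $Y\subseteq X$. For $\mathcal{G}\subseteq\mathcal{AR}$, $\mathcal{G}|X=\{a\in\mathcal{G}:a\subseteq X\}$. $\mathcal{R}_1(n)=\{X(n):X\in\mathcal{R}_1\}$, $\mathcal{R}_1(n)|X=\{Y(n):Y\le X\}$. $\mathcal{U}_1$ is an ultrafilter on base set $\mathbb{T}$ which is Ramsey for $\mathcal{R}_1$: $\mathcal{U}_1=\{U\subseteq\mathbb{T}:\exists X\in\mathcal{C}'\ X\subseteq U\}$ for some $\mathcal{C}'\subseteq\mathcal{R}_1$ such that for every $\mathcal{G}\subseteq\mathcal{AR}$ and partition $\mathcal{G}=\mathcal{G}_0\cup\mathcal{G}_1$ there are $X\in\mathcal{C}'$, $i\in2$ with $\mathcal{G}_i|X=\emptyset$. Standing assumption: moreover, for every front $\mathcal{F}$ on $\mathcal{R}_1$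 (a set $\mathcal{F}\subseteq\mathcal{AR}$ no member of which is a proper initial approximation $r_m$ of another, such that every $X\in\mathcal{R}_1$ has some $r_m(X)\in\mathcal{F}$) and every equivalence relation on $\mathcal{F}$, there is $U\in\mathcal{U}_1\cap\mathcal{R}_1$ on which the relation is canonical (represented, maximally, by an inner Sperner map on $\mathcal{F}|U$). Let $\mathcal{C}=\mathcal{U}_1\cap\mathcal{R}_1$. For $n\ge1$, $\mathcal{Y}_n$ is the ultrafilter on $\mathcal{R}_1(n-1)$ generated by $\mathcal{R}_1(n-1)|X$, $X\in\mathcal{C}$; $\mathcal{Y}_0$ is the ultrafilter on $\{\{\langle\rangle,\langle k\rangle\}:k<\omega\}$ generated by the sets $\{\{\langle\rangle,\langle k\rangle\}:\langle k\rangle\in X\}$, $X\in\mathcal{C}$. $\mathcal{V}\le_T\mathcal{U}$ means some map $\mathcal{U}\to\mathcal{V}$ sends every base of $\mathcal{U}$ to a base of $\mathcal{V}$.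
   Formalization: The partition property is required only for G with no member a proper initial approximation of another (for all G it is contradictory); ''ultrafilter on T'' means its trace on the maximal nodes is an ultrafilter; V lives on a countable base set. *)

(* Defs.v *)
From mathcomp Require Import all_boot.
From mathcomp Require Import boolp classical_sets functions cardinality filter.

Set Implicit Arguments.
Unset Strict Implicit.
Unset Printing Implicit Defensive.

Local Open Scope classical_set_scope.

(** * Ultrafilters on a subset of a type *)

(* [F] is an ultrafilter on the base set [B], given as a family of subsets of
   [B]; the library's [UltraFilter] is about the whole type. *)
Definition ultrafilter_on (T : Type) (B : set T) (F : set_system T) : Prop :=
  (forall A, F A -> A `<=` B) /\ UltraFilter [set A | F (A `&` B)].

Definition nonprincipal (T : Type) (F : set_system T) : Prop :=
  forall x : T, ~ F [set x].

(* Isomorphism of a family [F] on [B] with a family [G] on [D]. *)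
Definition isomorphic (T T' : Type) (B : set T) (F : set_system T)
    (D : set T') (G : set_system T') : Prop :=
  exists2 f : T -> T', set_bij B D f &
    forall A, A `<=` B -> (F A <-> G (f @` A)).

Definition base_of (T : Type) (F B : set_system T) : Prop :=
  B `<=` F /\ forall A, F A -> exists2 A', B A' & A' `<=` A.

(* [tukey_le G F] is G <=_T F; only the values of [f] on [F] matter, and they
   lie in [G] since [F] is a base of itself. *)
Definition tukey_le (T T' : Type) (G : set_system T') (F : set_system T) : Prop :=
  exists f : set T -> set T', forall B, base_of F B -> base_of G (f @` B).

(** * The space R_1 *)

Definition node := seq nat.

Definition TT : set node :=
  [set s | s = [::] \/ (exists n, s = [:: n]) \/
           exists n i, i <= n /\ s = [:: n; i]].

Definition leaves : set node := [set s | TT s /\ size s = 2].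

(* {<>, <k>} together with the <k, i>, i in L. *)
Definition block (k : nat) (L : set nat) : set node :=
  [set s | s = [::] \/ s = [:: k] \/ exists2 i, L i & s = [:: k; i]].

Definition presents (k : nat -> nat) (L : nat -> set nat) (X : set node) : Prop :=
  [/\ {homo k : m n / m < n},
      forall n, L n `<=` [set i | i <= k n],
      forall n, (L n #= `I_n.+1)%card
    & X = \bigcup_n block (k n) (L n)].

Definition R1 : set (set node) := [set X | exists k L, presents k L X].

(* X(n): the sequences (k_n) and (L_n) presenting X are unique. *)
Definition part (X : set node) (n : nat) : set node :=
  [set s | exists k L, presents k L X /\ block (k n) (L n) s].

Definition approx (n : nat) (X : set node) : set node :=
  \bigcup_(i in `I_n) part X i.

Definition AR : set (set node) :=
  [set a | exists2 X, R1 X & exists n, a = approx n X].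

Definition below (G : set (set node)) (X : set node) : set (set node) :=
  [set a | G a /\ a `<=` X].

Definition proper_initial (a b : set node) : Prop :=
  exists2 X, R1 X & exists m n, [/\ m < n, a = approx m X & b = approx n X].

Definition Nash_Williams (G : set (set node)) : Prop :=
  G `<=` AR /\ forall a b, G a -> G b -> ~ proper_initial a b.

Definition front (F : set (set node)) : Prop :=
  Nash_Williams F /\ forall X, R1 X -> exists m, F (approx m X).

(** * Canonical equivalence relations *)

Definition equivalence_on (T : Type) (D : set T) (E : T -> T -> Prop) : Prop :=
  [/\ forall a, D a -> E a a,
      forall a b, D a -> D b -> E a b -> E b a
    & forall a b c, D a -> D b -> D c -> E a b -> E b c -> E a c].

Definition inner (D : set (set node)) (phi : set node -> set node) : Prop :=
  forall a, D a -> phi a `<=` a.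

Definition Sperner (D : set (set node)) (phi : set node -> set node) : Prop :=
  forall a b, D a -> D b -> ~ phi a `<` phi b.

Definition represents (D : set (set node)) (E : set node -> set node -> Prop)
    (phi : set node -> set node) : Prop :=
  forall a b, D a -> D b -> (E a b <-> phi a = phi b).

Definition inner_Sperner_rep (D : set (set node))
    (E : set node -> set node -> Prop) (phi : set node -> set node) : Prop :=
  [/\ inner D phi, Sperner D phi & represents D E phi].

Definition canonical_on (F : set (set node)) (E : set node -> set node -> Prop)
    (U : set node) : Prop :=
  exists2 phi, inner_Sperner_rep (below F U) E phi &
    forall phi', inner_Sperner_rep (below F U) E phi' ->
      exists Y, [/\ R1 Y, Y `<=` U &
                 forall a, below F Y a -> phi' a `<=` phi a].

(** * Ultrafilters Ramsey for R_1 *)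

(* Members of R_1 contain the inner nodes of TT below their leaves, so that no
   family generated by members of R_1 can decide {<>}: "ultrafilter on TT" is
   meant with TT identified with its maximal nodes.  [U1] is kept as a family of
   subsets of TT, and its trace on the maximal nodes is an ultrafilter.
   The partition property is for Nash-Williams families: it fails for AR itself,
   split by parity of length, since r_0(X) and r_1(X) are both below X. *)
Definition Ramsey_for_R1 (U1 : set_system node) : Prop :=
  ultrafilter_on leaves [set U `&` leaves | U in U1] /\
  exists C' : set (set node),
    [/\ C' `<=` R1,
        U1 = [set U | U `<=` TT /\ exists2 X, C' X & X `<=` U]
      & forall G G0 G1, Nash_Williams G -> G = G0 `|` G1 -> G0 `&` G1 = set0 ->
          exists2 X, C' X & below G0 X = set0 \/ below G1 X = set0].

Definition canonization (U1 : set_system node) : Prop :=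
  forall F E, front F -> equivalence_on F E ->
    exists2 U, (U1 `&` R1) U & canonical_on F E U.

(** * The ultrafilters Y_n *)

(* R_1(n-1)|X for n >= 1, and {{<>, <k>} : <k> in X} for n = 0. *)
Definition Ygen (n : nat) (X : set node) : set (set node) :=
  if n is m.+1 then [set part Y m | Y in [set Y | R1 Y /\ Y `<=` X]]
  else [set [set [::]; [:: k]] | k in [set k | X [:: k]]].

Definition Ybase (n : nat) : set (set node) :=
  if n is m.+1 then [set part X m | X in R1]
  else [set [set [::]; [:: k]] | k in [set: nat]].

Definition Yult (U1 : set_system node) (n : nat) : set_system (set node) :=
  [set A | A `<=` Ybase n /\ filter_from (U1 `&` R1) (Ygen n) A].

(** * Ultrafilters of W-trees *)

Section WTrees.
Variable L : Type.
Implicit Types (S H : set (seq L)) (s t : seq L).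

Definition initial_segment s t : Prop := exists u, t = s ++ u.

Definition prefix_free S : Prop :=
  forall s t, S s -> S t -> initial_segment s t -> s = t.

Definition hat S : set (seq L) := [set s | exists2 t, S t & initial_segment s t].

Definition no_infinite_branch H : Prop :=
  ~ exists b : nat -> L, forall n, H (mkseq b n).

Definition succs H s : set (seq L) := [set u | H u /\ exists x, u = rcons s x].

Definition W_tree S (W : seq L -> set_system (seq L)) H : Prop :=
  [/\ H `<=` hat S,
      H [::],
      forall s t, H t -> initial_segment s t -> H s
    & forall s, (H `\` S) s -> W s (succs H s)].

Definition W_tree_ultrafilter S (W : seq L -> set_system (seq L)) :
    set_system (seq L) :=
  [set A | A `<=` S /\ filter_from (W_tree S W) (fun H => H `&` S) A].

End WTrees.

(* The successor s^<t> of s is identified with its last entry t: the last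
   entries run over the base set of Y_n, and W_s is the corresponding copy of
   Y_n. *)
Definition copy_of_Y (U1 : set_system node) (n : nat)
    (S : set (seq (set node))) (s : seq (set node))
    (Ws : set_system (seq (set node))) : Prop :=
  succs (hat S) s = rcons s @` Ybase n /\
  Ws = [set rcons s @` A | A in Yult U1 n].

(* Main.v *)
Require Import Defs.
From mathcomp Require Import all_boot.
From mathcomp Require Import zify.
From mathcomp Require Import boolp classical_sets functions cardinality filter.

(** A Tukey map yields a monotone g from U_1 to V with cofinal image.  Attach to
    a finite union of blocks [a] the principal ultrafilter at x when x lies in
    g(a `|` Z) for all Z in U_1, and otherwise the Y_(n+1)-limit of the ultrafilters
    attached to the one-block extensions of [a].  A fusion, which exists because
    the Ramsey property for pairs of blocks makes U_1 selective, shows that this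
    recursion reaches the empty approximation, and the ultrafilter attached to
    it contains every g(Z), hence is V.

    It remains to see that a Y_n-limit of ultrafilters v_b, each given by a
    well-founded tree, is given by such a tree.  If some v_b is the limit, we
    are done.  Otherwise an Erdos-Rado argument gives a set J of positions such
    that on some X in C, v_b = v_c iff b and c have the same level and the same
    leaves at the positions in J.  So the limit is a Y_|J|-limit of distinct
    ultrafilters, and selectivity separates these by pairwise disjoint sets,
    which allows grafting their trees onto a root with successors Ybase |J|. *)

Set Implicit Arguments.
Unset Strict Implicit.
Unset Printing Implicit Defensive.

Local Open Scope classical_set_scope.

(** * Ultrafilters through elementary closure properties *)

Record ultra (T : Type) (F : set_system T) : Prop := Ultra {
  ultraT : F setT;
  ultraI : forall A B, F A -> F B -> F (A `&` B);
  ultraS : forall A B, A `<=` B -> F A -> F B;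
  ultra0 : ~ F set0;
  ultraC : forall A, ~ F A -> F (~` A) }.

Lemma ultraP (T : Type) (F : set_system T) : UltraFilter F <-> ultra F.
Proof.
split=> [UF|[FT FI FS F0 FC]].
  split; [exact: filterT | move=> *; exact: filterI | |exact: filter_not_empty|].
    by move=> A B AB; apply: filterS.
  by move=> A nA; case: (in_ultra_setVsetC A UF).
have PF : ProperFilter F.
  apply: Build_ProperFilter => //; split=> //.
split=> // G GP FG; rewrite eqEsubset; split=> // A GA.
apply: contrapT => /FC /FG GC; apply: (@filter_not_empty _ G).
by rewrite -(setICr A); apply: filterI.
Qed.

Lemma ultraN (T : Type) (F : set_system T) A : ultra F -> F A -> ~ F (~` A).
Proof.
by move=> uF FA /(ultraI uF FA); rewrite setICr; apply: ultra0 uF.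
Qed.

Lemma ultra_ex (T : Type) (F : set_system T) A : ultra F -> F A -> exists x, A x.
Proof.
move=> uF FA; apply: contrapT => nA; apply: (ultra0 uF).
by apply: ultraS FA => // x Ax; apply: nA; exists x.
Qed.

Lemma ultra_max (T : Type) (F G : set_system T) : ultra F -> ultra G ->
  F `<=` G -> F = G.
Proof.
move=> uF uG FG; rewrite eqEsubset; split=> // A GA.
apply: contrapT => /(ultraC uF) /FG; exact: ultraN.
Qed.

Lemma ultra_sep (T : Type) (F G : set_system T) : ultra F -> ultra G ->
  F <> G -> exists2 A, F A & ~ G A.
Proof.
move=> uF uG FG; apply: contrapT => nA; apply: FG; apply: ultra_max => // A FA.
by apply: contrapT => GA; apply: nA; exists A.
Qed.

Lemma ultra_bigcap (T : Type) (J : choiceType) (F : set_system T) (D : set J)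
    (A : J -> set T) : ultra F -> finite_set D -> (forall j, D j -> F (A j)) ->
  F (\bigcap_(j in D) A j).
Proof.
move=> /ultraP uF fD FA; rewrite -(fset_setK fD).
by apply: filter_bigI => j; rewrite in_fset_set // inE; apply: FA.
Qed.

Lemma finite_seqs (T : eqType) (D : set T) n : finite_set D ->
  finite_set [set s : seq T | size s <= n /\ forall x, x \in s -> D x].
Proof.
move=> fD; elim: n => [|n IH].
  by apply: sub_finite_set (finite_set1 [::]) => -[|x s] [].
have f1 := finite_image (fun p => p.1 :: p.2) (finite_setX fD IH).
apply: sub_finite_set (_ : finite_set ([set [::]] `|` _)); last first.
  by rewrite finite_setU; split; [exact: finite_set1 | exact: f1].
move=> [|x s] [/= ss sD]; first by left.
right; exists (x, s) => //=; split=> /=; first by apply: sD; rewrite mem_head.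
by split=> // y ys; apply: sD; rewrite inE ys orbT.
Qed.

(** * Blocks *)

(* [(k, s)] stands for the block {<>, <k>} together with the <k, i>, i in s. *)
Notation nblock := (nat * seq nat)%type.

(** Strict increase of the list makes the code of a block unique. The number [n] of leaves may be 0,
    which covers the base set of Y_0. *)
Definition is_nblock n (b : nblock) : bool :=
  [&& sorted ltn b.2, size b.2 == n & all (fun i => i <= b.1) b.2].

Definition blk (b : nblock) : set node := block b.1 [set` b.2].

(** By [YgenE] this codes [Ygen n X], so that Y_0 and the later Y_n are treated uniformly. *)
Definition blks n (X : set node) : set nblock :=
  [set b | is_nblock n b /\ blk b `<=` X].

Lemma blkP b X : blk b `<=` X <->
  [/\ X [::], X [:: b.1] & forall i, i \in b.2 -> X [:: b.1; i]].
Proof.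
split=> [bX|[X0 X1 X2] s].
  split=> [||i ib]; apply: bX; [by left | by right; left|].
  by right; right; exists i.
by case=> [->|[->|[i /= ib ->]]] //; apply: X2.
Qed.

Lemma blk_level b k : blk b [:: k] <-> k = b.1.
Proof. by split=> [[|[[]|[]]]|->] //; right; left. Qed.

Lemma blk_leaf b k i : blk b [:: k; i] <-> k = b.1 /\ i \in b.2.
Proof.
split=> [[|[|[j jb [-> ->]]]]|[-> ib]] //.
by right; right; exists i.
Qed.

Lemma nblock_inj n m b c : is_nblock n b -> is_nblock m c -> blk b = blk c -> b = c.
Proof.
case: b c => [k s] [l t] /and3P[/= ss _ _] /and3P[/= st _ _] e.
have kl : k = l by apply/(blk_level (l, t)); rewrite -e; apply/blk_level.
subst l; congr pair; apply: (irr_sorted_eq ltn_trans ltnn) => // i.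
apply/idP/idP => ib.
  by apply: (proj2 (_ : k = k /\ _)); apply/(blk_leaf (k, t)); rewrite -e; apply/blk_leaf.
by apply: (proj2 (_ : k = k /\ _)); apply/(blk_leaf (k, s)); rewrite e; apply/blk_leaf.
Qed.

Lemma blksS n X Y : X `<=` Y -> blks n X `<=` blks n Y.
Proof. by move=> XY b [bn bX]; split=> //; apply: subset_trans XY. Qed.

Lemma finite_nblocks n k : finite_set [set b | is_nblock n b /\ b.1 <= k].
Proof.
have f1 : finite_set [set i | i <= k].
  by apply: sub_finite_set (finite_II k.+1).
apply: sub_finite_set (finite_setX f1 (finite_seqs n f1)).
move=> -[l s] [/= /and3P[/= _ /eqP <- /allP sl] lk]; split=> //=; split=> // i /sl.
by move/leq_trans; apply.
Qed.

Definition bpres (b : nat -> nblock) (X : set node) : Prop :=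
  [/\ forall m n, m < n -> (b m).1 < (b n).1,
      forall n, is_nblock n.+1 (b n) & X = \bigcup_n blk (b n)].

Lemma card_seq_uniq (s : seq nat) : uniq s -> ([set` s] #= `I_(size s))%card.
Proof.
move=> us; apply: card_esym; apply/card_set_bijP; exists (nth 0 s); split.
- by move=> i /= si; apply: mem_nth.
- by move=> i j; rewrite !inE /= => si sj /eqP; rewrite nth_uniq // => /eqP.
- by move=> x /= xs; exists (index x s); rewrite ?nth_index //= index_mem.
Qed.

Lemma bpres_presents b X : bpres b X ->
  presents (fun n => (b n).1) (fun n => [set` (b n).2]) X.
Proof.
move=> [bl bn ->]; split=> // n; have /and3P[s /eqP e ab] := bn n.
  by move=> i /=; apply: (allP ab).
by rewrite -e; apply: card_seq_uniq; apply: (sorted_uniq ltn_trans ltnn).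
Qed.

Lemma presents_bpres k L X : presents k L X ->
  exists2 b, bpres b X & forall n, block (k n) (L n) = blk (b n).
Proof.
move=> [ki Lk Lc ->].
pose s n := [seq i <- iota 0 (k n).+1 | `[< L n i >]].
have sL n : [set` s n] = L n.
  apply/seteqP; split=> i /=; rewrite mem_filter mem_iota.
    by case/andP => /asboolP.
  by move=> Li; rewrite asboolT //= add0n ltnS; apply: (Lk n).
have ss n : sorted ltn (s n).
  by apply: (sorted_filter ltn_trans); apply: iota_ltn_sorted.
exists (fun n => (k n, s n)); last by move=> n; rewrite /blk /= sL.
split=> [|n|]; first exact: ki.
  rewrite /is_nblock /= ss /=; apply/andP; split.
    apply/eqP/card_eq_II; apply: card_eq_trans (Lc n).
    rewrite -(sL n) card_eq_sym; apply: card_seq_uniq.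
    exact: (sorted_uniq ltn_trans ltnn).
  by apply/allP => i; rewrite mem_filter mem_iota add0n ltnS => /and3P[].
by apply: eq_bigcupr => n _; rewrite /blk /= sL.
Qed.

Lemma R1P X : R1 X <-> exists b, bpres b X.
Proof.
split=> [[k [L /presents_bpres[b bX _]]]|[b /bpres_presents bX]]; first by exists b.
by exists (fun n => (b n).1), (fun n => [set` (b n).2]).
Qed.

Lemma inc_leq (k : nat -> nat) : (forall m n, m < n -> k m < k n) ->
  forall n, n <= k n.
Proof. by move=> ki; elim=> // n IH; apply: leq_ltn_trans (ki n n.+1 _). Qed.

Lemma inc_lt (k : nat -> nat) : (forall m n, m < n -> k m < k n) ->
  forall m n, k m < k n -> m < n.
Proof.
move=> ki m n kmn; rewrite ltnNge; apply/negP; rewrite leq_eqVlt => /orP[/eqP e|/ki].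
  by rewrite e ltnn in kmn.
by move=> /(ltn_trans kmn); rewrite ltnn.
Qed.

Lemma inc_inj (k : nat -> nat) : (forall m n, m < n -> k m < k n) -> injective k.
Proof.
by move=> ki m n e; case: (ltngtP m n) => // /ki; rewrite e ltnn.
Qed.

Lemma inc_range_uniq (k l : nat -> nat) :
  (forall m n, m < n -> k m < k n) -> (forall m n, m < n -> l m < l n) ->
  range k = range l -> k =1 l.
Proof.
move=> ki li kl; elim/ltn_ind => n IH.
suff H (f g : nat -> nat) : (forall m n, m < n -> f m < f n) ->
    (forall m n, m < n -> g m < g n) -> range f = range g ->
    (forall m, m < n -> f m = g m) -> g n <= f n.
  by apply/eqP; rewrite eqn_leq !H // => m /IH.
(* If f n < g n, then f n is an earlier value g m = f m, against injectivity of f. *)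
move=> fi gi fg e; rewrite leqNgt; apply/negP => lt.
have : range g (f n) by rewrite -fg; exists n.
case=> m _ gm; have mn : m < n by apply: (inc_lt gi); rewrite gm.
by move: gm; rewrite -e // => /(inc_inj fi) eq; rewrite eq ltnn in mn.
Qed.

Lemma bpres_level b X k : bpres b X -> X [:: k] <-> exists n, k = (b n).1.
Proof.
move=> [_ _ ->]; split=> [[n _ /blk_level ->]|[n ->]]; exists n => //.
exact/blk_level.
Qed.

Lemma bpres_leaf b X k i : bpres b X ->
  X [:: k; i] <-> exists n, k = (b n).1 /\ i \in (b n).2.
Proof.
move=> [_ _ ->]; split=> [[n _ /blk_leaf ?]|[n ?]]; exists n => //.
exact/blk_leaf.
Qed.

Lemma bpres_root b X : bpres b X -> X [::].
Proof. by move=> [_ _ ->]; exists 0 => //; left. Qed.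

Lemma bpres_uniq b c X : bpres b X -> bpres c X -> b =1 c.
Proof.
move=> bX cX; have [bi bn _] := bX; have [ci cn _] := cX.
have e1 : (fun n => (b n).1) =1 (fun n => (c n).1).
  apply: inc_range_uniq => //; apply/seteqP; split=> k [n _ <-].
    have : X [:: (b n).1] by apply/(bpres_level _ bX); exists n.
    by move/(bpres_level _ cX) => [m ->]; exists m.
  have : X [:: (c n).1] by apply/(bpres_level _ cX); exists n.
  by move/(bpres_level _ bX) => [m ->]; exists m.
suff H (f g : nat -> nblock) : bpres f X -> bpres g X ->
    (forall n, (f n).1 = (g n).1) -> forall n i, i \in (f n).2 -> i \in (g n).2.
  move=> n; rewrite [b n]surjective_pairing [c n]surjective_pairing; congr pair.
    exact: e1.
  have /and3P[sb _ _] := bn n; have /and3P[sc _ _] := cn n.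
  apply: (irr_sorted_eq ltn_trans ltnn) => // i.
  by apply/idP/idP; apply: H.
move=> fX gX e n i fi; have : X [:: (f n).1; i] by apply/(bpres_leaf _ _ fX); exists n.
move/(bpres_leaf _ _ gX) => [m []]; rewrite e => em.
by have [gi _ _] := gX; rewrite (inc_inj gi em).
Qed.

(** [part] quantifies over all presentations of [X]; by [bpres_uniq] they all have the same
    blocks. *)
Lemma partE b X n : bpres b X -> part X n = blk (b n).
Proof.
move=> bX; apply/seteqP; split=> s.
  move=> [k [L [/presents_bpres[c cX ->]]]].
  by rewrite (bpres_uniq cX bX).
move=> bs; exists (fun n => (b n).1), (fun n => [set` (b n).2]); split=> //.
exact: bpres_presents.
Qed.

Lemma approxE b X n : bpres b X -> approx n X = \bigcup_(i in `I_n) blk (b i).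
Proof. by move=> bX; apply: eq_bigcupr => i _; apply: partE. Qed.

Lemma bpres_blk b X n : bpres b X -> blk (b n) `<=` X.
Proof. by move=> [_ _ ->] s bs; exists n. Qed.

Lemma R1_root X : R1 X -> X [::].
Proof. by move=> /R1P[b]; apply: bpres_root. Qed.

Lemma R1_leaf_level X k i : R1 X -> X [:: k; i] -> X [:: k].
Proof.
move=> /R1P[b bX] /(bpres_leaf _ _ bX)[n [-> _]].
by apply/(bpres_level _ bX); exists n.
Qed.

Lemma R1_TT X : R1 X -> X `<=` TT.
Proof.
move=> /R1P[b [_ bn ->]] s [n _ [->|[->|[i /= ib ->]]]].
- by left.
- by right; left; exists (b n).1.
right; right; exists (b n).1, i; split=> //.
by have /and3P[_ _ /allP] := bn n; apply.
Qed.

(** Every block of a member of R_1 has a leaf, so its inner nodes are recovered from its leaves.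
    This transfers facts about the trace of U_1 on the leaves to U_1 itself. *)
Lemma R1_leaves_sub X Y : R1 X -> R1 Y -> X `&` leaves `<=` Y -> X `<=` Y.
Proof.
move=> RX RY XY; have /R1P[b [_ bn e]] := RX.
suff H n : blk (b n) `<=` Y by rewrite e => s [n _]; apply: H.
have leafY i : i \in (b n).2 -> Y [:: (b n).1; i].
  move=> ib; apply: XY; split.
    by rewrite e; exists n => //; apply/blk_leaf.
  split=> //; right; right; exists (b n).1, i; split=> //.
  by have /and3P[_ _ /allP] := bn n; apply.
apply/blkP; split=> //; first exact: R1_root.
have /and3P[_ /eqP sb _] := bn n.
apply: (R1_leaf_level RY (leafY (nth 0 (b n).2 0) _)).
by apply: mem_nth; rewrite sb.
Qed.

Lemma blks_in_block b X n c : bpres b X -> blks n X c ->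
  exists j, [/\ c.1 = (b j).1, {subset c.2 <= (b j).2} & n <= j.+1].
Proof.
move=> bX [/and3P[sc /eqP <- _] /blkP[_ /(bpres_level _ bX)[j e] cX]]; exists j.
have sub : {subset c.2 <= (b j).2}.
  move=> i /cX /(bpres_leaf _ _ bX)[m []]; rewrite e => em.
  by have [bi _ _] := bX; rewrite (inc_inj bi em).
split=> //; have [_ bn _] := bX; have /and3P[_ /eqP <- _] := bn j.
by apply: uniq_leq_size => //; apply: (sorted_uniq ltn_trans ltnn).
Qed.

Lemma is_nblock_take m n (b : nblock) : m <= n -> is_nblock n b ->
  is_nblock m (b.1, take m b.2).
Proof.
move=> mn /and3P[/= sb /eqP szb /allP ab]; apply/and3P; split=> /=.
- exact: take_sorted.
- by rewrite size_takel ?szb.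
- by apply/allP => i /mem_take; apply: ab.
Qed.

Lemma bpres_extend b X n (c : nat -> nblock) : bpres b X ->
  (forall i, i < n -> blks i.+1 X (c i)) ->
  (forall i j, i < j < n -> (c i).1 < (c j).1) ->
  exists d Y, [/\ bpres d Y, Y `<=` X & forall i, i < n -> d i = c i].
Proof.
move=> bX cX ci; have [bi bn _] := bX.
(* Levels in [b] are at least their indices, so blocks of [X] from index [K] on lie above the last
   prescribed block. They are trimmed to the required number of leaves. *)
pose K := if n is m.+1 then (c m).1.+1 else 0.
pose d i := if i < n then c i else ((b (K + i)).1, take i.+1 (b (K + i)).2).
have dX i : blks i.+1 X (d i).
  rewrite /d; case: ifP => [/cX //|_]; split.
    by apply: is_nblock_take (bn _); rewrite ltnS leq_addl.
  apply: subset_trans (@bpres_blk b X (K + i) bX); apply/blkP => /=; split.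
  - by left.
  - exact/blk_level.
  by move=> j /mem_take jb; apply/blk_leaf.
exists d, (\bigcup_i blk (d i)); split; first split=> //.
- move=> i j ij; rewrite /d; case: (ltnP i n) => ni; case: (ltnP j n) => nj /=.
  + by apply: ci; rewrite ij.
  + apply: leq_trans (inc_leq bi _); rewrite /K.
    case: n ni ci {cX K d dX nj} => // n; rewrite ltnS leq_eqVlt => /orP[/eqP ->|lt] ci.
      exact: leq_addr.
    by apply: leq_trans (leq_addr _ _); apply: ltnW; rewrite ltnS; apply: ci; rewrite lt /=.
  + by move: (leq_ltn_trans ni (ltn_trans ij nj)); rewrite ltnn.
  + by apply: bi; rewrite ltn_add2l.
- by move=> i; case: (dX i).
- by move=> s [i _]; have [_] := dX i; apply.
- by move=> i lt; rewrite /d lt.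
Qed.

(** A block with n + 1 leaves sits in a block of [X] of index at least n, so the first n blocks of
    [X] can be put before it. *)
Lemma blks_extend X n c : R1 X -> blks n.+1 X c ->
  exists d Y, [/\ bpres d Y, Y `<=` X & d n = c].
Proof.
move=> /R1P[b bX] cX; have [j [e _ nj]] := blks_in_block bX cX.
have [bi bn _] := bX.
have [||d [Y [dY YX dc]]] := @bpres_extend b X n.+1 (fun i => if i < n then b i else c) bX.
- move=> i; rewrite ltnS leq_eqVlt => /orP[/eqP ->|lt]; first by rewrite ltnn.
  by rewrite lt; split=> //; apply: bpres_blk bX.
- move=> i i' /andP[ii']; rewrite ltnS => i'n; rewrite (leq_trans ii' i'n).
  case: (ltnP i' n) => _; first exact: bi.
  by rewrite e; apply: bi; apply: (leq_trans ii'); apply: (leq_trans i'n).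
by exists d, Y; split=> //; rewrite dc // ltnn.
Qed.

(** A leafless block is never a part of a member of R_1; only its level can be realized, by a first
    block with one leaf. *)
Lemma blks0_extend X c : R1 X -> blks 0 X c ->
  exists d Y, [/\ bpres d Y, Y `<=` X & (d 0).1 = c.1].
Proof.
move=> /R1P[b bX] cX; have [j [e _ _]] := blks_in_block bX cX.
have [_ bn _] := bX.
pose c' := ((b j).1, take 1 (b j).2).
have [||d [Y [dY YX dc]]] := @bpres_extend b X 1 (fun=> c') bX.
- case=> // _; split; first exact: is_nblock_take (bn j).
  apply: subset_trans (@bpres_blk b X j bX); apply/blkP => /=; split.
  - by left.
  - exact/blk_level.
  by move=> i /mem_take ib; apply/blk_leaf.
- by case=> [|i] [|i'] // /andP[].
by exists d, Y; split=> //; rewrite dc.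
Qed.

Lemma YgenE n X : R1 X -> Ygen n X = blk @` blks n X.
Proof.
move=> RX; case: n => [|n] /=; apply/seteqP; split=> z.
- move=> [k /= Xk <-]; exists (k, [::]); last first.
    apply/seteqP; split=> s; first by case=> [->|[->|[]]] //; [left|right].
    by case=> ->; [left | right; left].
  by split=> //; apply/blkP; split=> //; apply: R1_root.
- move=> [[k s]] [/and3P[_ /eqP /size0nil /= -> _] /blkP[_ /= Xk _]] <-.
  exists k => //; apply/seteqP; split=> t; last by case=> [->|[->|[]]] //; [left|right].
  by case=> ->; [left | right; left].
- move=> [Y [/R1P[d dY] YX] <-]; exists (d n); last by rewrite (partE n dY).
  by split; [case: dY | apply: subset_trans YX; apply: bpres_blk].
- move=> [c cX <-]; have [d [Y [dY YX <-]]] := blks_extend RX cX.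
  by exists Y; [split=> //; apply/R1P; exists d | rewrite (partE n dY)].
Qed.

Lemma bpres_TT : bpres (fun n => (n, iota 0 n.+1)) TT.
Proof.
split=> [//|n|].
  rewrite /is_nblock (iota_ltn_sorted 0 n.+1) size_iota eqxx.
  by apply/allP => i; rewrite mem_iota.
apply/seteqP; split=> s.
  case=> [->|[[n ->]|[n [i [ni ->]]]]].
  - by exists 0 => //; left.
  - by exists n => //; right; left.
  - by exists n => //; apply/blk_leaf; rewrite /= -[_ :: _]/(iota 0 n.+1) mem_iota.
case=> n _ [->|[->|[i /=]]]; [by left | by right; left; exists n|].
rewrite -[_ :: _]/(iota 0 n.+1) mem_iota => lt ->.
by right; right; exists n, i.
Qed.

Lemma R1_TT_self : R1 TT.
Proof. by apply/R1P; eexists; apply: bpres_TT. Qed.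

Lemma blks_TT n : blks n TT = [set b | is_nblock n b].
Proof.
apply/seteqP; split=> b; first by case.
move=> bn; split=> //; have /and3P[_ _ /allP ab] := bn.
apply/blkP; split; [by left | by right; left; exists b.1 | move=> i ib].
by right; right; exists b.1, i; split=> //; apply: ab.
Qed.

Lemma YbaseE n : Ybase n = blk @` [set b | is_nblock n b].
Proof.
rewrite -blks_TT -YgenE; last exact: R1_TT_self.
case: n => [|n] /=; apply/seteqP; split=> z.
- by move=> [k _ <-]; exists k => //=; right; left; exists k.
- by move=> [k _ <-]; exists k.
- by move=> [X RX <-]; exists X => //; split=> //; apply: R1_TT.
- by move=> [X [RX _] <-]; exists X.
Qed.

(** * Initial approximations of a fixed length *)

Lemma approx_sub b X n : bpres b X -> approx n X `<=` X.
Proof. by move=> bX s; rewrite (approxE n bX) => -[i _]; apply: bpres_blk. Qed.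

Lemma approx_level b X n k : bpres b X ->
  approx n X [:: k] <-> exists2 i, i < n & k = (b i).1.
Proof.
move=> bX; rewrite (approxE n bX); split=> [[i /= lt /blk_level ->]|[i lt ->]].
  by exists i.
by exists i => //; apply/blk_level.
Qed.

Lemma approx_length b X c Z m n : bpres b X -> bpres c Z ->
  approx m X = approx n Z -> m = n.
Proof.
move=> bX cZ e; suff H b' X' c' Z' p q : bpres b' X' -> bpres c' Z' ->
    approx p X' = approx q Z' -> p <= q.
  by apply/eqP; rewrite eqn_leq (H _ _ _ _ _ _ bX cZ e) (H _ _ _ _ _ _ cZ bX).
move=> bX' cZ' e'; have [bi _ _] := bX'.
rewrite -(size_iota 0 p) -(size_map (fun i => (b' i).1)).
rewrite -[leqRHS](size_iota 0) -[leqRHS](size_map (fun i => (c' i).1)).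
apply: uniq_leq_size; first by rewrite (map_inj_uniq (inc_inj bi)) iota_uniq.
move=> k /mapP[i]; rewrite mem_iota /= add0n => lt ->.
have : approx p X' [:: (b' i).1] by apply/(approx_level _ _ bX'); exists i.
rewrite e' => /(approx_level _ _ cZ')[j ltj ->].
by apply: map_f; rewrite mem_iota.
Qed.

(** The partition property is applied to these families only. They are Nash-Williams because the
    length of an approximation is the number of its levels. *)
Definition ARn n : set (set node) := [set approx n X | X in R1].

Lemma ARn_Nash_Williams n : Nash_Williams (ARn n).
Proof.
split=> [a [X RX <-]|a b [X /R1P[c cX] <-] [Z /R1P[d dZ] <-]]; first by exists X => //; exists n.
move=> [Q /R1P[e eQ] [p [q [pq e1 e2]]]].
have := approx_length cX eQ e1; have := approx_length dZ eQ e2.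
by move=> e3 e4; rewrite -e3 -e4 ltnn in pq.
Qed.

Lemma approx_top_block b X n c : bpres b X -> is_nblock n.+1 c ->
  blk c `<=` approx n.+1 X -> c = b n.
Proof.
move=> bX cn ca; have cX : blks n.+1 X c.
  by split=> //; apply: (subset_trans ca); apply: approx_sub bX.
have [j [e sub nj]] := blks_in_block bX cX; have [bi bn _] := bX.
have /(blkP)[_ /(approx_level _ _ bX)[i] lt e' _] := ca.
have eij : i = j by apply: (inc_inj bi); rewrite -e' -e.
rewrite eij in lt; have ejn : j = n by apply/eqP; rewrite eqn_leq -ltnS lt -ltnS nj.
rewrite ejn in e sub; apply: injective_projections => //.
have /and3P[sc /eqP szc _] := cn; have /and3P[sb /eqP szb _] := bn n.
apply: (irr_sorted_eq ltn_trans ltnn) => // k.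
have uc := sorted_uniq ltn_trans ltnn sc.
have szle : size (b n).2 <= size c.2 by rewrite szb szc.
by have [_] := uniq_min_size uc sub szle.
Qed.

(** * The ultrafilters Y_n and selectivity *)

Definition nY (U1 : set_system node) n : set_system nblock :=
  [set A | exists2 X, (U1 `&` R1) X & blks n X `<=` A].

Lemma YultE U1 n A : Yult U1 n A <-> A `<=` Ybase n /\ nY U1 n (blk @^-1` A).
Proof.
split=> -[AY [X [UX RX] XA]]; split=> //; exists X => //.
  by move=> b bX; apply: XA; rewrite YgenE //; exists b.
by rewrite YgenE // => _ [b bX <-]; apply: XA.
Qed.

Section RamseyUltrafilter.
Variables (U1 : set_system node) (U1_Ramsey : Ramsey_for_R1 U1).

Local Notation C := (U1 `&` R1).
Local Notation Y := (nY U1).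

(** The Ramsey hypothesis gives intersections only for traces on the leaves; [R1_leaves_sub] lifts
    them to members of R_1. *)
Lemma C_dir U U' : U1 U -> U1 U' -> exists2 X, C X & X `<=` U `&` U'.
Proof.
have [[trl trU] [C' [C'R U1E _]]] := U1_Ramsey.
have base U'' : U1 U'' -> exists2 X, C X & X `<=` U''.
  rewrite U1E => -[_ [X C'X XU]]; exists X => //; split; last exact: C'R.
  by split; [apply: R1_TT; apply: C'R | exists X].
have tr X : U1 X -> [set A | [set U `&` leaves | U in U1] (A `&` leaves)] X.
  by move=> UX; exists X.
move=> /base[X [UX RX] XU] /base[X' [UX' RX'] XU'].
have := ultraI (proj1 (ultraP _) trU) (tr _ UX) (tr _ UX').
move=> [U'' /base[Z [UZ RZ] ZU''] e]; exists Z => //.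
have ZXX : Z `&` leaves `<=` X `&` X'.
  move=> s [Zs ls]; have : (U'' `&` leaves) s by split=> //; apply: ZU''.
  by rewrite e => -[].
rewrite subsetI; split.
  by apply: subset_trans XU; apply: R1_leaves_sub => // s /ZXX[].
by apply: subset_trans XU'; apply: R1_leaves_sub => // s /ZXX[].
Qed.

Lemma C_ex : exists X, C X.
Proof.
have [_ [C' [C'R U1E pr]]] := U1_Ramsey.
have [||X C'X _] := pr (ARn 0) (ARn 0) set0 (ARn_Nash_Williams 0).
- by rewrite setU0.
- by rewrite setI0.
exists X; split; last exact: C'R.
by rewrite U1E; split; [apply: R1_TT; apply: C'R | exists X].
Qed.

Lemma C_homog n (Q : set (set node)) : exists2 X, C X &
  (forall a, ARn n a -> a `<=` X -> Q a) \/ (forall a, ARn n a -> a `<=` X -> ~ Q a).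
Proof.
have [_ [C' [C'R U1E pr]]] := U1_Ramsey.
have [||X C'X h] := pr (ARn n) (ARn n `&` Q) (ARn n `\` Q) (ARn_Nash_Williams n).
- by rewrite setUIDK.
- by rewrite -subset0 => a [[_ Qa] []].
exists X.
  split; last exact: C'R.
  by rewrite U1E; split; [apply: R1_TT; apply: C'R | exists X].
case: h => h; [right=> a Ga aX Qa | left=> a Ga aX].
  by rewrite -[False]/((set0 : set (set node)) a) -h; split.
by apply: contrapT => nQ; rewrite -[False]/((set0 : set (set node)) a) -h; split.
Qed.

Lemma C_finite_dir (J : eqType) (D : set J) (Q : J -> set node -> Prop) :
  finite_set D ->
  (forall j X Z, Q j X -> Z `<=` X -> Q j Z) ->
  (forall j, D j -> exists2 X, C X & Q j X) ->
  exists2 X, C X & forall j, D j -> Q j X.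
Proof.
move=> /finite_seqP[s ->] Qm; elim: s => [|j s IH] sQ.
  by have [X CX] := C_ex; exists X.
have [|X [UX _] XQ] := IH; first by move=> i /= si; apply: sQ; rewrite /= inE si orbT.
have [|X' [UX' _] jX'] := sQ j; first by rewrite /= mem_head.
have [Z CZ ZX] := C_dir UX UX'; exists Z => // i /=.
rewrite inE => /orP[/eqP ->|si].
  by apply: Qm jX' _ => u /ZX[].
by apply: Qm (XQ i si) _ => u /ZX[].
Qed.

Lemma blks_nonempty n X : R1 X -> exists b, blks n X b.
Proof.
move=> /R1P[b bX]; exists ((b n).1, take n (b n).2).
have [_ bn _] := bX; split; first exact: is_nblock_take (leqnSn n) (bn n).
apply: subset_trans (@bpres_blk b X n bX); apply/blkP; split; [by left|exact/blk_level|].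
by move=> i /mem_take ib; apply/blk_leaf.
Qed.

Lemma nY_homog n (Q : set nblock) : exists2 X, C X &
  blks n X `<=` Q \/ blks n X `<=` ~` Q.
Proof.
(* An approximation of length [m] contains exactly one block with n leaves; for n = 0 the length is
   1, and this block is its only level. *)
pose m := n.-1.+1.
have [X CX h] := C_homog m [set a | exists b, [/\ is_nblock n b, blk b `<=` a & Q b]].
exists X => //; have [_ RX] := CX.
have top c : blks n X c -> exists a, [/\ ARn m a, a `<=` X, blk c `<=` a &
    forall b, is_nblock n b -> blk b `<=` a -> b = c].
  clear h; rewrite {}/m; case: n Q => [|n] Q /= cX.
    have [d [Z [dZ ZX dc]]] := blks0_extend RX cX.
    exists (approx 1 Z); split; first by exists Z => //; apply/R1P; exists d.
    - by apply: subset_trans ZX; apply: approx_sub dZ.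
    - have [/and3P[_ /eqP c0 _] _] := cX.
      apply/blkP; split; first by rewrite (approxE 1 dZ); exists 0 => //; left.
        by apply/(approx_level _ _ dZ); exists 0.
      by rewrite (size0nil c0).
    move=> b /and3P[_ /eqP b0 _] /blkP[_ /(approx_level _ _ dZ)[[|//] _ e] _].
    have [/and3P[_ /eqP c0 _] _] := cX.
    apply: injective_projections; first by rewrite e.
    by rewrite (size0nil b0) (size0nil c0).
  have [d [Z [dZ ZX dc]]] := blks_extend RX cX.
  exists (approx n.+1 Z); split; first by exists Z => //; apply/R1P; exists d.
  - by apply: subset_trans ZX; apply: approx_sub dZ.
  - by rewrite (approxE _ dZ) -dc => s ds; exists n => //=.
  by move=> b bn ba; rewrite -dc; apply: approx_top_block dZ _ ba.
case: h => h; [left | right] => c cX; have [a [Ga aX ca uc]] := top c cX.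
  by have [b [bn ba Qb]] := h a Ga aX; rewrite -(uc b bn ba).
by move=> Qc; apply: (h a Ga aX); exists c; split=> //; case: cX.
Qed.

Lemma nY_ultra n : ultra (Y n).
Proof.
split.
- by have [X CX] := C_ex; exists X.
- move=> A B [X [UX _] XA] [X' [UX' _] XB]; have [Z CZ ZX] := C_dir UX UX'.
  exists Z => // b bZ; split.
    by apply: XA; apply: blksS bZ => s /ZX[].
  by apply: XB; apply: blksS bZ => s /ZX[].
- by move=> A B AB [X CX XA]; exists X => //; apply: subset_trans AB.
- by move=> [X [_ RX] X0]; have [b /X0] := blks_nonempty n RX.
move=> A nA; have [X CX [XA|XA]] := nY_homog n A; last by exists X.
by case: nA; exists X.
Qed.

Lemma nY_blks n U : U1 U -> Y n (blks n U).
Proof.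
by move=> UU; have [X CX XU] := C_dir UU UU; exists X => //; apply: blksS => s /XU[].
Qed.

Lemma nY_is_nblock n : Y n [set b | is_nblock n b].
Proof. by have [X CX] := C_ex; exists X => // b []. Qed.

(* Ramsey for pairs of consecutive blocks gives a diagonal intersection. *)
Lemma C_selective (Z : nat -> set node) : (forall k, C (Z k)) ->
  exists2 X, C X & forall k b m, X [:: k] -> blks m X b -> k < b.1 -> blks m (Z k) b.
Proof.
move=> CZ.
(* An approximation of length 2 is coloured by whether the leaves of its upper block lie in [Z k],
   where k is its lower level. *)
have [X CX h] := C_homog 2 [set a | forall k l i, k < l ->
  a [:: k] -> a [:: l] -> a [:: l; i] -> Z k [:: l; i]].
have [UX RX] := CX; have /R1P[x xX] := RX; have [xi xn _] := xX.
have pair p q t : p < q -> sorted ltn t -> size t = 2 -> {subset t <= (x q).2} ->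
    exists2 a, [/\ ARn 2 a, a `<=` X, a [:: (x p).1] & a [:: (x q).1]] &
    (forall i, i \in t -> a [:: (x q).1; i]) /\
    (forall k l i, k < l -> a [:: k] -> a [:: l; i] ->
       [/\ k = (x p).1, l = (x q).1 & i \in t]).
  move=> pq st szt tx.
  pose c i := if i is 0 then ((x p).1, take 1 (x p).2) else ((x q).1, t).
  have [||d [W [dW WX dc]]] := @bpres_extend x X 2 c xX.
  - case=> [|[|//]] _ /=; split.
    + exact: is_nblock_take (xn p).
    + apply: subset_trans (@bpres_blk x X p xX); apply/blkP => /=.
      split; [by left | exact/blk_level | move=> i /mem_take ?; exact/blk_leaf].
    + rewrite /is_nblock /= st szt; apply/allP => i /tx.
      by have /and3P[_ _ /allP] := xn q; apply.
    + apply: subset_trans (@bpres_blk x X q xX); apply/blkP => /=.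
      split; [by left | exact/blk_level | move=> i /tx ?; exact/blk_leaf].
  - by move=> [|i] [|[|j]] /andP[] //= _ _; apply: xi.
  have aE := approxE 2 dW.
  have lev k : approx 2 W [:: k] -> k = (x p).1 \/ k = (x q).1.
    move=> /(approx_level _ _ dW)[[|[|//]] _ ->]; rewrite dc //; by [left|right].
  exists (approx 2 W); split.
  - by exists W => //; apply/R1P; exists d.
  - by apply: subset_trans WX; apply: approx_sub dW.
  - by apply/(approx_level _ _ dW); exists 0; rewrite ?dc.
  - by apply/(approx_level _ _ dW); exists 1; rewrite ?dc.
  - by move=> i it; rewrite aE; exists 1 => //; rewrite dc //; apply/blk_leaf.
  move=> k l i kl /lev ak; rewrite aE => -[[|[|//]] _]; rewrite dc // => /blk_leaf[/= e it].
    by case: ak kl => ->; rewrite e ?ltnn // ltnNge ltnW ?xi.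
  by case: ak kl => ->; rewrite e ?ltnn.
exists X => //; case: h => h; last first.
  (* The negative colour is refuted inside [X] and the set [Z] attached to its first level: the
     index [q] below exceeds that level, so the block of [Z'] with this index lies above it and has
     two leaves to form a pair. *)
  have [Z' [UZ' RZ'] Z'X] := C_dir UX (proj1 (CZ (x 0).1)).
  have /R1P[z zZ] := RZ'; have [zi zn _] := zZ.
  pose q := (x 0).1.+1.
  have : X [:: (z q).1] by apply: (proj1 (Z'X _ _)); apply/(bpres_level _ zZ); exists q.
  move=> /(bpres_level _ xX)[q' eq'].
  have lt0 : (x 0).1 < (x q').1 by rewrite -eq'; apply: inc_leq zi q.
  have /and3P[st /eqP szt _] := is_nblock_take (isT : 2 <= q.+1) (zn q).
  have zl i : i \in take 2 (z q).2 -> Z' [:: (z q).1; i].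
    by move=> /mem_take iz; apply/(bpres_leaf _ _ zZ); exists q.
  have [|a [Ga aX a0 aq] [at' ua]] := pair 0 q' _ (inc_lt xi lt0) st szt.
    move=> i /zl /Z'X[] /(bpres_leaf _ _ xX)[r [e ir]] _.
    by rewrite eq' in e; rewrite (inc_inj xi e).
  case: (h a Ga aX) => k l i kl ak _ al.
  have [-> -> /zl] := ua k l i kl ak al.
  by rewrite eq' => /Z'X[].
move=> k b m /(bpres_level _ xX)[p ->] bX pb; have [q [eb sub _]] := blks_in_block xX bX.
have pq : p < q by apply: (inc_lt xi); rewrite -eb.
have /and3P[sx /eqP szx _] := xn q; have ux := sorted_uniq ltn_trans ltnn sx.
have leafZ i : i \in (x q).2 -> Z (x p).1 [:: (x q).1; i].
  move=> ix.
  (* The upper block of an approximation of length 2 has two leaves, so [i] needs a companion; one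
     exists since q > 0. *)
  have [j jx ij] : exists2 j, j \in (x q).2 & i != j.
    have [e|ne] := eqVneq i (nth 0 (x q).2 0); last first.
      by exists (nth 0 (x q).2 0) => //; apply: mem_nth; rewrite szx.
    have q1 : 1 < size (x q).2 by rewrite szx ltnS (leq_ltn_trans _ pq).
    exists (nth 0 (x q).2 1); first exact: mem_nth.
    by rewrite e nth_uniq // szx.
  pose t := if i < j then [:: i; j] else [:: j; i].
  have it : i \in t by rewrite /t; case: ifP; rewrite !inE eqxx ?orbT.
  have [|||a [Ga aX ap aq] [at' _]] := pair p q t pq.
  - by rewrite /t; case: ltnP => /=; rewrite andbT // leq_eqVlt eq_sym (negbTE ij).
  - by rewrite /t; case: ifP.
  - by move=> y; rewrite /t; case: ifP => _; rewrite !inE => /orP[] /eqP ->.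
  by apply: (h a Ga aX) => //; [apply: xi | apply: at'].
have RZ : R1 (Z (x p).1) by case: (CZ (x p).1).
split; first by case: bX.
apply/blkP; split; first exact: R1_root.
  rewrite eb; apply: (R1_leaf_level RZ (leafZ (nth 0 (x q).2 0) _)).
  by apply: mem_nth; rewrite szx.
by move=> i /sub /leafZ; rewrite eb.
Qed.

(** Only finitely many blocks with n leaves have a given level, so one member of C serves all of
    them, and selectivity combines these members over all levels. *)
Lemma nY_diag n (R : nblock -> nblock -> Prop) :
  Y n [set b | Y n [set c | R b c]] ->
  exists2 X, C X & forall b c, blks n X b -> blks n X c -> b.1 < c.1 -> R b c.
Proof.
move=> [X0 [UX0 _] X0R].
have /choice[Z CZ] : forall k, exists Z, C Z /\
    forall b c, blks n X0 b -> b.1 = k -> blks n Z c -> R b c.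
  move=> k; pose Q b Z := blks n Z `<=` R b.
  have [|||Z CZ ZQ] := @C_finite_dir _ [set b | blks n X0 b /\ b.1 = k] Q.
  - apply: sub_finite_set (finite_nblocks n k) => b [[bn _] bk].
    by split=> //; rewrite bk.
  - by move=> b Z Z' ZQ Z'Z c cZ'; apply: ZQ; apply: blksS cZ'.
  - by move=> b [/X0R].
  by exists Z; split=> // b c bX bk cZ; apply: ZQ.
have [X [UX RX] XZ] := C_selective (fun k => proj1 (CZ k)).
have [X' CX' X'X] := C_dir UX UX0; exists X' => // b c bX' cX' bc.
have [_ CR] := CZ b.1; apply: CR => //.
  by apply: blksS bX' => s /X'X[].
apply: XZ => //; last by apply: blksS cX' => s /X'X[].
by have [_ /blkP[_ /X'X[]]] := bX'.
Qed.

End RamseyUltrafilter.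

(** * Canonical equivalence relations on increasing sequences *)

(** An increasing n-tuple is coded by a function whose values from n on are arbitrary; [T_ext] below
    makes the relation insensitive to them. *)
Definition inc_on n (f : nat -> nat) := forall i j, i < j -> j < n -> f i < f j.

Lemma bounded_on n (f : nat -> nat) : exists N, forall i, i < n -> f i < N.
Proof.
exists (\max_(i < n) f i).+1 => i lt; rewrite ltnS.
exact: (leq_bigmax_cond (Ordinal lt)).
Qed.

Section ErdosRado.
Variables (n : nat) (T : (nat -> nat) -> (nat -> nat) -> Prop).
Hypothesis T_ext : forall f g, inc_on n f -> inc_on n g ->
  (forall i, i < n -> f i = g i) -> T f g.
Hypothesis T_sym : forall f g, inc_on n f -> inc_on n g -> T f g -> T g f.
Hypothesis T_trans : forall f g h, inc_on n f -> inc_on n g -> inc_on n h ->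
  T f g -> T g h -> T f h.
Hypothesis T_inv : forall N u f g, inc_on N u -> inc_on n f -> inc_on n g ->
  (forall i, i < n -> f i < N) -> (forall i, i < n -> g i < N) ->
  (T (u \o f) (u \o g) <-> T f g).

Definition move_at j (f g : nat -> nat) :=
  [/\ inc_on n f, inc_on n g, f j < g j & forall i, i < n -> i != j -> f i = g i].

(** By [move_canonical], if one move of the coordinate leaves the class, then all of them do. *)
Definition essential j := exists2 f, exists g, move_at j f g /\ ~ T f g & j < n.

Lemma inc_onT (u : nat -> nat) : (forall i j, i < j -> u i < u j) ->
  forall f, inc_on n f -> inc_on n (u \o f).
Proof. by move=> ui f fi i j ij jn /=; apply: ui; apply: fi. Qed.

Lemma T_invT (u : nat -> nat) f g : (forall i j, i < j -> u i < u j) ->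
  inc_on n f -> inc_on n g -> T f g -> T (u \o f) (u \o g).
Proof.
move=> ui fi gi Tfg.
have [N fN] := bounded_on n f; have [M gM] := bounded_on n g.
apply/(@T_inv (maxn N M) u f g) => //.
- by move=> i j ij _; apply: ui.
- by move=> i /fN lt; rewrite leq_max lt.
- by move=> i /gM lt; rewrite leq_max lt orbT.
Qed.

(* Every one-coordinate move is an increasing image of the move of [j] to
   [j + 1] inside [{0, ..., n}]. *)
Lemma move_canonical j f g : j < n -> move_at j f g ->
  T f g <-> T (fun i => if i <= j then i else i.+1) (fun i => if i < j then i else i.+1).
Proof.
move=> jn [fi gi fg e].
set c := fun i => if i <= j then i else i.+1.
set d := fun i => if i < j then i else i.+1.
(* The map [u] enumerates the n + 1 values of [f] and [g] together: [f] up to j, then [g] from j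
   on. *)
pose u i := if i <= j then f i else g i.-1.
have ci : inc_on n c by move=> i k ik kn; rewrite /c; case: (leqP i j); case: (leqP k j); lia.
have di : inc_on n d by move=> i k ik kn; rewrite /d; case: (ltnP i j); case: (ltnP k j); lia.
have fleg i : i < n -> f i <= g i.
  by move=> lt; have [->|ne] := eqVneq i j; [apply: ltnW | rewrite e].
have ui : inc_on n.+1 u.
  move=> i k ik kn; rewrite /u; case: (leqP i j) => ij; case: (leqP k j) => kj.
  - by apply: fi => //; lia.
  - have [eij|ne] := eqVneq i k.-1.
      by rewrite -eij (_ : i = j) //; lia.
    by apply: leq_ltn_trans (fleg i _) (gi _ _ _ _); lia.
  - lia.
  - by apply: gi; lia.
have ufc i : i < n -> (u \o c) i = f i.
  move=> lt; rewrite /u /c /=; case: (leqP i j) => ij; first by rewrite ij.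
  by rewrite ifF ?e //=; lia.
have ugd i : i < n -> (u \o d) i = g i.
  move=> lt; rewrite /u /d /=; case: (ltnP i j) => ij.
    by rewrite ltnW // e // neq_ltn ij.
  by rewrite ifF //; lia.
have uci : inc_on n (u \o c) by move=> i k ik kn; rewrite !ufc ?fi //; lia.
have udi : inc_on n (u \o d) by move=> i k ik kn; rewrite !ugd ?gi //; lia.
have cN i : i < n -> c i < n.+1 by rewrite /c; case: (leqP i j); lia.
have dN i : i < n -> d i < n.+1 by rewrite /d; case: (ltnP i j); lia.
rewrite -(T_inv ui ci di cN dN); split=> Tfg.
  apply: (T_trans uci fi udi); first exact: T_ext.
  apply: (T_trans fi gi udi Tfg); apply: T_ext => // i lt; by rewrite ugd.
apply: (T_trans fi uci gi); first by apply: T_ext => // i lt; rewrite ufc.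
by apply: (T_trans uci udi gi Tfg); apply: T_ext.
Qed.

(** Coordinates of [g] are replaced by those of [f] one at a time from the left; f <= g keeps the
    hybrids increasing, and each step that changes anything moves an inessential coordinate. *)
Lemma agree_T_le f g : inc_on n f -> inc_on n g -> (forall i, i < n -> f i <= g i) ->
  (forall i, i < n -> essential i -> f i = g i) -> T g f.
Proof.
move=> fi gi fg e.
pose c m i := if i < m then f i else g i.
have ci m : inc_on n (c m).
  move=> i j ij jn; rewrite /c; case: (ltnP i m) => im; case: (ltnP j m) => jm.
  - exact: fi.
  - by apply: leq_ltn_trans (fg i _) (gi _ _ ij jn); lia.
  - lia.
  - exact: gi.
have H m : m <= n -> T g (c m).
  elim: m => [_|m IH mn]; first exact: T_ext.
  apply: (T_trans gi (ci m) (ci m.+1)); first by apply: IH; lia.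
  have cm i : i != m -> c m i = c m.+1 i.
    by move=> ne; rewrite /c ltnS [i <= m]leq_eqVlt (negbTE ne).
  have [eq|ne] := eqVneq (f m) (g m).
    apply: T_ext => // i lt; have [->|/cm //] := eqVneq i m.
    by rewrite /c ltnn leqnn.
  apply: T_sym => //; apply: contrapT => nT.
  have es : essential m.
    exists (c m.+1) => //; exists (c m); split=> //; split=> //.
      by rewrite /c ltnn leqnn ltn_neqAle ne fg.
    by move=> i lt /cm.
  by move/eqP: ne; apply; apply: e.
apply: (T_trans gi (ci n) fi (H n _)) => //; apply: T_ext => // i lt.
by rewrite /c lt.
Qed.

Lemma agree_T f g : inc_on n f -> inc_on n g ->
  (forall i, i < n -> essential i -> f i = g i) -> T f g.
Proof.
(* The pointwise minimum is increasing and below both, which reduces the claim to comparable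
   tuples. *)
move=> fi gi e; pose h i := minn (f i) (g i).
have hi : inc_on n h.
  by move=> i j ij jn; rewrite /h; have := fi i j ij jn; have := gi i j ij jn; lia.
apply: (T_trans fi hi gi).
  apply: agree_T_le => // i lt; first exact: geq_minl.
  by move=> /(e i lt) eq; rewrite /h eq minnn.
apply: T_sym => //; apply: agree_T_le => // i lt; first exact: geq_minr.
by move=> /(e i lt) eq; rewrite /h eq minnn.
Qed.

(** If equivalent tuples first disagree at an essential j, they yield equivalent [a], [b] with a j
    not a value of [b]. Two increasing maps differing only at a j agree on [b], so both images of
    [a] are equivalent, although they form a move of j. *)
Lemma T_agree f g : inc_on n f -> inc_on n g -> T f g ->
  forall i, i < n -> essential i -> f i = g i.
Proof.
move=> fi gi Tfg; elim/ltn_ind => j IH jn ej; apply: contrapT => /eqP ne.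
wlog lt : f g fi gi Tfg IH ne / f j < g j.
  move=> W; case: (ltngtP (f j) (g j)) => [lt|lt|eq]; last by rewrite eq eqxx in ne.
    exact: (W f g).
  apply: (W g f) => //; [exact: T_sym | | by rewrite eq_sym].
  by move=> m mj mn em; rewrite IH.
(* Doubling makes room to push the value 2 f j out of the range of [b]; by [gj] below this alters no
   essential coordinate. *)
pose a i := 2 * f i; pose b i := if g i == f j then (2 * f j).+1 else 2 * g i.
have gj i : i < n -> essential i -> g i != f j.
  move=> lti ei; apply/eqP => eq.
  have ij : i < j.
    by case: (ltngtP i j) => // [ji|eij]; [have := gi j i ji lti | subst i]; lia.
  by have := IH i ij lti ei; have := fi i j ij jn; lia.
have dbl : forall i k, i < k -> 2 * i < 2 * k by lia.
have ai : inc_on n a by apply: (inc_onT dbl fi).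
have g2i : inc_on n (fun i => 2 * g i) by apply: (inc_onT dbl gi).
have bi : inc_on n b.
  move=> i k ik kn; rewrite /b; have := gi i k ik kn.
  by case: eqP; case: eqP; lia.
have Tab : T a b.
  apply: (T_trans ai g2i bi); first exact: (T_invT dbl).
  apply: agree_T => // i lti ei; rewrite /b ifN //; exact: gj.
(* These maps differ only at a j = 2 f j, a value missed by [b]. *)
pose h1 x := 2 * x; pose h2 x := if x == 2 * f j then (2 * x).+1 else 2 * x.
have h2i : forall i k, i < k -> h2 i < h2 k.
  by move=> i k; rewrite /h2; do 2 case: eqP; lia.
have T1 := T_invT dbl ai bi Tab.
have T2 := T_invT h2i ai bi Tab.
have i1a := inc_onT dbl ai; have i1b := inc_onT dbl bi.
have i2a := inc_onT h2i ai; have i2b := inc_onT h2i bi.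
have T12 : T (h1 \o a) (h2 \o a).
  apply: (T_trans i1a i1b i2a T1); apply: (T_trans i1b i2b i2a); last exact: T_sym.
  apply: T_ext => // i lti; rewrite /= /h2 /b.
  by case: (eqVneq (g i) (f j)) => gfj; case: eqP => //; lia.
have mv : move_at j (h1 \o a) (h2 \o a).
  split=> //; first by rewrite /= /h1 /h2 /a eqxx.
  move=> i lti nij; rewrite /= /h1 /h2 ifF // /a; apply/eqP => eq.
  by case: (ltngtP i j) nij => // ij _; [have := fi i j ij jn | have := fi j i ij lti]; lia.
have [f' [g' [mv' nT]] _] := ej; apply: nT.
by apply/(move_canonical jn mv'); apply/(move_canonical jn mv).
Qed.

(** Invariance under increasing maps replaces the usual passage to an infinite homogeneous set, so
    the canonical form holds for all tuples. *)
Lemma Erdos_Rado f g : inc_on n f -> inc_on n g ->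
  T f g <-> (forall i, i < n -> essential i -> f i = g i).
Proof. by move=> fi gi; split; [apply: T_agree | apply: agree_T]. Qed.

End ErdosRado.

(** * Subblocks at given positions and canonization of functions on blocks *)

Lemma sorted_incP (s : seq nat) : sorted ltn s <-> inc_on (size s) (nth 0 s).
Proof.
split=> [ss i j ij js|h].
  by apply: (sorted_ltn_nth ltn_trans 0 ss) => //; rewrite inE // (ltn_trans ij).
by apply/(sortedP 0) => i lt; apply: h.
Qed.

Lemma mask_eqP (J : bitseq) (s t : seq nat) : size s = size J -> size t = size J ->
  mask J s = mask J t <-> (forall i, i < size J -> nth false J i -> nth 0 s i = nth 0 t i).
Proof.
elim: J s t => [|x J IH] [|y s] [|z t] //= [es] [et].
have {}IH := IH s t es et; case: x; split.
- by move=> [-> /IH h] [|i] //=; apply: h.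
- move=> h; congr cons; first exact: (h 0).
  by apply/IH => i lt; apply: (h i.+1).
- by move=> /IH h [|i] //=; apply: h.
- by move=> h; apply/IH => i lt; apply: (h i.+1).
Qed.

Definition select (b : nblock) n (f : nat -> nat) : nblock :=
  (b.1, mkseq (fun i => nth 0 b.2 (f i)) n).

Lemma select_blks b X M N u : blks M X b -> inc_on N u ->
  (forall i, i < N -> u i < M) -> blks N X (select b N u).
Proof.
move=> [/and3P[sb /eqP szb /allP ab] /blkP[X0 X1 X2]] ui uM.
have mem i : i \in (select b N u).2 -> i \in b.2.
  by move=> /mapP[j]; rewrite mem_iota /= => lt ->; apply: mem_nth; rewrite szb; apply: uM.
split; last by apply/blkP; split=> // i /mem /X2.
apply/and3P; split=> /=; last by apply/allP => i /mem; apply: ab.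
  apply/sorted_incP; rewrite size_mkseq => i j ij jN.
  rewrite !nth_mkseq ?(ltn_trans ij) //; move/sorted_incP : sb; apply; first exact: ui.
  by rewrite szb uM.
by rewrite size_mkseq.
Qed.

Lemma select_ext b n f g : (forall i, i < n -> f i = g i) -> select b n f = select b n g.
Proof.
move=> e; rewrite /select /mkseq; congr pair; apply/eq_in_map => i.
by rewrite mem_iota /= => lt; rewrite e.
Qed.

Lemma select_select b N u n f : (forall i, i < n -> f i < N) ->
  select (select b N u) n f = select b n (u \o f).
Proof.
move=> fN; rewrite /select /=; congr pair; apply/eq_in_map => i.
by rewrite mem_iota /= => lt; rewrite nth_mkseq ?fN.
Qed.

Lemma mask_blks J X b : blks (size J) X b -> blks (count id J) X (b.1, mask J b.2).
Proof.
move=> [/and3P[sb /eqP szb /allP ab] /blkP[X0 X1 X2]].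
split; last by apply/blkP; split=> // i /mem_mask; apply: X2.
apply/and3P; split=> /=; last by apply/allP => i /mem_mask; apply: ab.
  exact: (sorted_mask ltn_trans).
by rewrite size_mask.
Qed.

Section Canonization.
Variables (U1 : set_system node) (U1_Ramsey : Ramsey_for_R1 U1).

Local Notation C := (U1 `&` R1).
Local Notation Y := (nY U1).
Let Y_ultra := nY_ultra U1_Ramsey.

Lemma nY_select M N u A : inc_on N u -> (forall i, i < N -> u i < M) ->
  Y N A -> Y M [set b | A (select b N u)].
Proof.
by move=> ui uM [X CX XA]; exists X => // b bX; apply: XA; apply: select_blks bX _ _.
Qed.

Lemma nY_mask J A : Y (count id J) A -> Y (size J) [set b | A (b.1, mask J b.2)].
Proof. by move=> [X CX XA]; exists X => // b bX; apply: XA; apply: mask_blks. Qed.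

Section Same.
Variables (n : nat) (A : Type) (v : nblock -> A).

(* [same f g]: for almost all blocks, the subblocks at the positions [f] and
   [g] have the same value. *)
Definition same_in N f g :=
  Y N [set b | v (select b n f) = v (select b n g)].

Definition same f g := exists2 N,
  (forall i, i < n -> f i < N /\ g i < N) & same_in N f g.

(** Selection at positions [u] sends Y_M to an ultrafilter containing Y_N, hence to Y_N. *)
Lemma nY_selectP M N u B : inc_on N u -> (forall i, i < N -> u i < M) ->
  Y N B <-> Y M [set b | B (select b N u)].
Proof.
move=> ui uM; split; first exact: nY_select.
move=> YM; apply: contrapT => /(ultraC (Y_ultra N)) /(nY_select ui uM).
exact: ultraN YM.
Qed.

Lemma same_in_comp M N u f g : inc_on N u -> (forall i, i < N -> u i < M) ->
  (forall i, i < n -> f i < N /\ g i < N) ->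
  same_in N f g <-> same_in M (u \o f) (u \o g).
Proof.
move=> ui uM fgN; rewrite /same_in (nY_selectP _ ui uM).
suff -> : [set b | [set b | v (select b n f) = v (select b n g)] (select b N u)] =
  [set b | v (select b n (u \o f)) = v (select b n (u \o g))] by [].
by apply/seteqP; split=> b /=; rewrite !select_select // => i /fgN[].
Qed.

(** Raising the bound amounts to selection along the identity, so any admissible bound decides
    [same]. *)
Lemma sameP N f g : (forall i, i < n -> f i < N /\ g i < N) ->
  same f g <-> same_in N f g.
Proof.
move=> fgN; split=> [[M fgM]|h]; last by exists N.
have mono P Q : P <= Q -> (forall i, i < n -> f i < P /\ g i < P) ->
    same_in P f g <-> same_in Q f g.
  move=> PQ fgP; have := @same_in_comp Q P id f g.
  by apply=> // i lt; apply: leq_trans PQ.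
have [MN|NM] := leqP M N; first by rewrite (mono M N).
by rewrite (mono N M) // ltnW.
Qed.

Lemma common_bound f g : exists N, forall i, i < n -> f i < N /\ g i < N.
Proof.
have [N fN] := bounded_on n f; have [M gM] := bounded_on n g.
exists (maxn N M) => i lt; split; rewrite leq_max ?fN //.
by rewrite gM // orbT.
Qed.

Lemma same_Erdos_Rado f g : inc_on n f -> inc_on n g ->
  same f g <-> (forall i, i < n -> essential n same i -> f i = g i).
Proof.
apply: Erdos_Rado => {f g}.
- move=> f g fi gi e; have [N fgN] := common_bound f g; apply/(sameP fgN).
  apply: (ultraS (Y_ultra N) _ (ultraT (Y_ultra N))) => b _ /=.
  by rewrite (select_ext _ e).
- move=> f g _ _ [N fgN h]; exists N; first by move=> i /fgN[].
  by apply: (ultraS (Y_ultra N) _ h) => b /= ->.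
- move=> f g h _ _ _ fg gh.
  have [N1 N1P] := common_bound f g; have [N2 N2P] := common_bound g h.
  have b1 i : i < n -> f i < maxn N1 N2 /\ g i < maxn N1 N2.
    by move=> /N1P[]; lia.
  have b2 i : i < n -> g i < maxn N1 N2 /\ h i < maxn N1 N2.
    by move=> /N2P[]; lia.
  have b3 i : i < n -> f i < maxn N1 N2 /\ h i < maxn N1 N2.
    by move=> lt; split; [case: (b1 i lt) | case: (b2 i lt)].
  move/(sameP b1) : fg => fg; move/(sameP b2) : gh => gh; apply/(sameP b3).
  apply: (ultraS (Y_ultra _) _ (ultraI (Y_ultra _) fg gh)) => b [/= -> //].
move=> N u f g ui fi gi fN gN.
have [M uM] := bounded_on N u.
have b1 i : i < n -> f i < N /\ g i < N by move=> lt; split; [apply: fN | apply: gN].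
have b2 i : i < n -> (u \o f) i < M /\ (u \o g) i < M.
  by move=> /b1[? ?]; split; apply: uM.
by rewrite (sameP b1) (sameP b2) (same_in_comp ui uM).
Qed.

End Same.

(** Two blocks of one level are subblocks, at positions f and g, of the block of their joint leaves.
    Only finitely many such f, g arise, so on one member of C equality of values is decided by
    [same f g], to which Erdos-Rado applies. *)
Lemma nY_canonical_same_level n (A : Type) (v : nblock -> A) :
  exists2 J : bitseq, size J = n & exists2 X, C X &
    forall b c, blks n X b -> blks n X c -> b.1 = c.1 ->
      (v b = v c <-> mask J b.2 = mask J c.2).
Proof.
pose J := mkseq (fun j => `[< essential n (same n v) j >]) n.
exists J; first by rewrite size_mkseq.
pose dom (i : nat * (seq nat * seq nat)) := [/\ inc_on n (nth 0 i.2.1),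
  inc_on n (nth 0 i.2.2) &
  forall j, j < n -> nth 0 i.2.1 j < i.1 /\ nth 0 i.2.2 j < i.1].
pose Q i X := dom i -> forall b, blks i.1 X b ->
  (v (select b n (nth 0 i.2.1)) = v (select b n (nth 0 i.2.2)) <->
   same n v (nth 0 i.2.1) (nth 0 i.2.2)).
(* Two blocks with n leaves have at most 2n leaves together, which bounds all positions. *)
pose D0 := [set s : seq nat | size s <= n /\ forall x, x \in s -> x < n + n].
have fD0 : finite_set D0 by apply: (finite_seqs n (finite_II (n + n))).
have fD := finite_setX (finite_II (n + n).+1) (finite_setX fD0 fD0).
have [||X CX XQ] := C_finite_dir U1_Ramsey fD (Q := Q).
- by move=> i X Z QX ZX di b bZ; apply: QX => //; apply: blksS bZ.
- move=> i _; have [di|ndi] := pselect (dom i); last by have [X] := C_ex U1_Ramsey; exists X.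
  have [i1 i2 bd] := di.
  have [s|ns] := pselect (same n v (nth 0 i.2.1) (nth 0 i.2.2)).
    have /(sameP v bd)[X CX XQ] := s.
    by exists X => // _ b bX; split=> // _; apply: XQ.
  have : ~ same_in n v i.1 (nth 0 i.2.1) (nth 0 i.2.2) by move=> /(sameP v bd).
  move=> /(ultraC (Y_ultra _))[X CX XQ]; exists X => // _ b bX.
  by split=> // /(XQ b bX).
exists X => // b c bX cX bc.
pose u := sort leq (undup (b.2 ++ c.2)).
have [/and3P[sb /eqP szb _] /blkP[X0 X1 Xb]] := bX.
have [/and3P[sc /eqP szc _] /blkP[_ _ Xc]] := cX.
have mu i : (i \in u) = (i \in b.2) || (i \in c.2).
  by rewrite mem_sort mem_undup mem_cat.
have uu : uniq u by rewrite sort_uniq undup_uniq.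
have su : sorted ltn u.
  by rewrite ltn_sorted_uniq_leq uu sort_sorted //; exact: leq_total.
have szu : size u <= n + n.
  by rewrite size_sort; apply: leq_trans (size_undup _) _; rewrite size_cat szb szc.
have idx (d : nblock) : is_nblock n d -> {subset d.2 <= u} -> d.1 = b.1 ->
    let l := map (index^~ u) d.2 in
    [/\ D0 l, inc_on n (nth 0 l), forall j, j < n -> nth 0 l j < size u,
        select (b.1, u) n (nth 0 l) = d & forall j, j < n -> nth 0 u (nth 0 l j) = nth 0 d.2 j].
  move=> /and3P[sd /eqP szd _] du d1 l.
  have lE j : j < n -> nth 0 l j = index (nth 0 d.2 j) u.
    by move=> lt; rewrite (nth_map 0) ?szd.
  have dm j : j < n -> nth 0 d.2 j \in u by move=> lt; apply/du/mem_nth; rewrite szd.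
  have lu j : j < n -> nth 0 l j < size u by move=> lt; rewrite lE // index_mem dm.
  have ul j : j < n -> nth 0 u (nth 0 l j) = nth 0 d.2 j.
    by move=> lt; rewrite lE // nth_index // dm.
  split=> //.
  - split; first by rewrite size_map szd.
    by move=> x /mapP[y /du yu ->]; apply: leq_trans szu; rewrite index_mem.
  - move=> i j ij jn; have iN := ltn_trans ij jn.
    have lt : nth 0 u (nth 0 l i) < nth 0 u (nth 0 l j).
      by rewrite !ul //; move/sorted_incP : sd; apply; rewrite ?szd.
    have inc := proj1 (sorted_incP u) su.
    case: (ltngtP (nth 0 l i) (nth 0 l j)) => // [gt|e]; last by rewrite e ltnn in lt.
    by have := inc _ _ gt (lu i iN); rewrite ltnNge ltnW.
  - rewrite /select /= -d1 [RHS]surjective_pairing; congr pair.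
    apply: (@eq_from_nth _ 0); rewrite size_mkseq ?szd // => i lt.
    by rewrite nth_mkseq // ul.
have [||//|D1 inc1 lu1 sel1 ul1] := idx b.
- by case: bX.
- by move=> i; rewrite mu => ->.
have [|||D2 inc2 lu2 sel2 ul2] := idx c.
- by case: cX.
- by move=> i; rewrite mu => ->; rewrite orbT.
- by [].
set l1 := map _ b.2 in D1 inc1 lu1 sel1 ul1; set l2 := map _ c.2 in D2 inc2 lu2 sel2 ul2.
have uX : blks (size u) X (b.1, u).
  split; last first.
    apply/blkP; split=> //= i; rewrite mu => /orP[/Xb //|/Xc]; by rewrite bc.
  apply/and3P; split=> //=; apply/allP => i; rewrite mu.
  have [/and3P[_ _ /allP ab] _] := bX; have [/and3P[_ _ /allP ac] _] := cX.
  by move=> /orP[/ab //|/ac]; rewrite bc.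
have := XQ (size u, (l1, l2)); rewrite /Q /= => h.
have {}h := h (conj (_ : size u < (n + n).+1) (conj D1 D2)).
have {h} := h szu (And3 inc1 inc2 (fun j lt => conj (lu1 j lt) (lu2 j lt))) _ uX.
rewrite sel1 sel2 => ->; rewrite (same_Erdos_Rado v inc1 inc2).
rewrite mask_eqP ?size_mkseq //; split=> h i lt.
  rewrite nth_mkseq // => /asboolP es; by rewrite -ul1 // -ul2 // h.
move=> es; apply/eqP; rewrite -(nth_uniq 0 _ _ uu) ?lu1 ?lu2 // ul1 // ul2 //.
by apply/eqP; apply: h => //; rewrite nth_mkseq //; apply/asboolP.
Qed.

(** The hypothesis and [nY_diag] separate the values at different levels, leaving the case of a
    common level. *)
Lemma nY_canonical n (A : Type) (v : nblock -> A) :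
  Y n [set b | Y n [set c | v b <> v c]] ->
  exists2 J : bitseq, size J = n & exists2 X, C X &
    forall b c, blks n X b -> blks n X c ->
      (v b = v c <-> b.1 = c.1 /\ mask J b.2 = mask J c.2).
Proof.
move=> /(nY_diag U1_Ramsey)[X [UX _] Xv].
have [J szJ [X' [UX' _] X'J]] := nY_canonical_same_level n v.
exists J => //; have [Z CZ ZX] := C_dir U1_Ramsey UX UX'; exists Z => // b c bZ cZ.
have [bX cX] : blks n X b /\ blks n X c by split; apply: blksS (_ : blks n Z _) => // s /ZX[].
have [bX' cX'] : blks n X' b /\ blks n X' c by split; apply: blksS (_ : blks n Z _) => // s /ZX[].
case: (ltngtP b.1 c.1) => [lt|gt|e].
- by split=> [e|[e]]; [case: (Xv _ _ bX cX lt) | move: lt; rewrite e ltnn].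
- by split=> [e|[e]]; [case: (Xv _ _ cX bX gt) | move: gt; rewrite e ltnn].
by rewrite (X'J b c) //; split=> [|[]].
Qed.

End Canonization.

(** * Ultrafilters of well-founded trees *)

Section WellFoundedTrees.
Variables (L : Type) (B : nat -> set L) (F : nat -> set_system L).
Hypothesis F_sub : forall n A, F n A -> A `<=` B n.
Hypothesis F_ultra : forall n, ultra [set A | F n (A `&` B n)].

(** Well-founded trees by construction: a node carries the index of its ultrafilter and a subtree
    for every label, of which those in the base set [B n] form the actual tree. *)
Inductive wtree := WLeaf | WNode of nat & (L -> wtree).

Fixpoint wS (t : wtree) : set (seq L) :=
  match t with
  | WLeaf => [set [::]]
  | WNode n c => [set s | if s is z :: s' then B n z /\ wS (c z) s' else False]
  end.

(** The iterated Fubini sum of the ultrafilters at the nodes; [W_tree_ultrafilterE] identifies it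
    with the ultrafilter generated by W-trees. *)
Fixpoint wU (t : wtree) : set_system (seq L) :=
  match t with
  | WLeaf => [set A | A [::]]
  | WNode n c => [set A | F n [set z | B n z /\ wU (c z) [set s | A (z :: s)]]]
  end.

Fixpoint wlabel (t : wtree) (s : seq L) : nat :=
  match t, s with
  | WNode n _, [::] => n
  | WNode _ c, z :: s' => wlabel (c z) s'
  | WLeaf, _ => 0
  end.

Definition wW t s : set_system (seq L) := [set rcons s @` A | A in F (wlabel t s)].

Lemma F_up n A A' : A `<=` A' -> A' `<=` B n -> F n A -> F n A'.
Proof.
move=> AA' A'B FA; have := ultraS (F_ultra n) AA'.
by rewrite /= (setIidl A'B) (setIidl (F_sub FA)); apply.
Qed.

Lemma F_setI n A A' : F n A -> F n A' -> F n (A `&` A').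
Proof.
move=> FA FA'; have := @ultraI _ _ (F_ultra n) A A'.
by rewrite /= -setIA (setIidl (F_sub FA)) (setIidl (F_sub FA')); apply.
Qed.

Lemma F_setD n A : A `<=` B n -> ~ F n A -> F n (B n `\` A).
Proof.
move=> AB nA; have := @ultraC _ _ (F_ultra n) A.
by rewrite /= (setIidl AB) setDE setIC; apply.
Qed.

Lemma F_base n : F n (B n).
Proof. by have := ultraT (F_ultra n); rewrite /= setTI. Qed.

Lemma F_set0 n : ~ F n set0.
Proof. by have := @ultra0 _ _ (F_ultra n); rewrite /= set0I. Qed.

Lemma wU_ultra t : ultra (wU t).
Proof.
elim: t => [|n c IH]; split=> //=.
- by move=> A A' AA'; apply: AA'.
- apply: F_up (F_base n) => [z Bz|z [] //]; split=> //.
  exact: ultraT (IH z).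
- move=> A A' FA FA'; apply: F_up (F_setI FA FA'); last by move=> z [].
  by move=> z [[Bz Az] [_ A'z]]; split=> //; apply: (ultraI (IH z)).
- move=> A A' AA'; apply: F_up; last by move=> z [].
  by move=> z [Bz Az]; split=> //; apply: ultraS Az; [exact: IH | move=> s; apply: AA'].
- move=> F0; apply: (@F_set0 n); apply: F_up F0 => // z [_ z0].
  exact: ultra0 (IH z) z0.
move=> A nA; have Asub : [set z | B n z /\ wU (c z) [set s | A (z :: s)]] `<=` B n.
  by move=> z [].
apply: F_up (F_setD Asub nA); last by move=> z [].
move=> z [Bz nz]; split=> //.
by apply: (ultraC (IH z)) => Az; apply: nz.
Qed.

Lemma wU_wS t : wU t (wS t).
Proof.
elim: t => [|n c IH] //=; apply: F_up (F_base n) => [z Bz|z []//]; split=> //=.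
by apply: ultraS (IH z); [exact: wU_ultra | move=> s].
Qed.

Lemma wS_nonempty t : exists s, wS t s.
Proof. exact: ultra_ex (wU_ultra t) (wU_wS t). Qed.

Lemma wS_prefix_free t : prefix_free (wS t).
Proof.
elim: t => [|n c IH] s u /=; first by move=> -> ->.
case: s u => [|z s] [|z' u] //= [_ Ss] [_ Su] [v [e1 e2]].
by subst z'; congr cons; apply: IH Ss Su _; exists v.
Qed.

Lemma hat_wSnil t : hat (wS t) [::].
Proof. by have [s Ss] := wS_nonempty t; exists s => //; exists s. Qed.

Lemma hat_wScons n c z s :
  hat (wS (WNode n c)) (z :: s) <-> B n z /\ hat (wS (c z)) s.
Proof.
split=> [[[|z' u] //= [Bz Su] [v [e1 e2]]]|[Bz [u Su [v e]]]].
  by subst z' u; split=> //; exists (s ++ v) => //; exists v.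
by exists (z :: u) => //; exists v; rewrite e.
Qed.

Lemma wS_wf t : no_infinite_branch (hat (wS t)).
Proof.
elim: t => [|n c IH] [b Hb].
  by have [u /= -> [v]] := Hb 1.
have /hat_wScons[Bz _] := Hb 1.
apply: (IH (b 0)); exists (fun n => b n.+1) => m.
have Hm : hat (wS (WNode n c)) (b 0 :: map b (iota 1 m)) := Hb m.+1.
have /hat_wScons[_] := Hm.
by rewrite -(addn0 1) iotaDl -map_comp.
Qed.

Lemma succs_wS t s : (hat (wS t) `\` wS t) s ->
  succs (hat (wS t)) s = rcons s @` B (wlabel t s).
Proof.
elim: t s => [|n c IH] s [].
  move=> [u /= -> [v]]; case: s => //= _ nS; by case: nS.
case: s => [|z s].
  move=> _ _; apply/seteqP; split=> u /=.
    by move=> [Hu [x eu]]; rewrite eu /= in Hu *; move: Hu => /hat_wScons[Bx _]; exists x.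
  move=> [x Bx <-]; split; last by exists x.
  by apply/hat_wScons; split=> //; apply: hat_wSnil.
move=> /hat_wScons[Bz Hs] nS; have := IH z s; rewrite /setD /= => e.
have {}e : succs (hat (wS (c z))) s = rcons s @` B (wlabel (c z) s).
  by apply: e; split=> // Ss; apply: nS.
apply/seteqP; split=> u.
  move=> [Hu [x eu]]; rewrite eu /= in Hu *; move: Hu => /hat_wScons[_ Hu].
  have : succs (hat (wS (c z))) s (rcons s x) by split=> //; exists x.
  by rewrite e => -[y By /rcons_inj[<-]]; exists y.
move=> [x Bx <-]; split; last by exists x.
have [] : succs (hat (wS (c z))) s (rcons s x) by rewrite e; exists x.
by move=> Hx _; apply/hat_wScons.
Qed.

Lemma W_tree_large t H A : W_tree (wS t) (wW t) H -> H `&` wS t `<=` A -> wU t A.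
Proof.
elim: t H A => [|n c IH] H A [Hhat H0 Hseg HW] HA; first exact: HA.
have [D FD De] := HW [::] (conj H0 id); rewrite /= in FD.
apply: (F_up _ _ FD); last by move=> z [].
move=> z Dz; have Bz := F_sub FD Dz.
have [Hz _] : succs H [::] [:: z] by rewrite -De; exists z.
(* The part of [H] above a first entry z is itself a W-tree for the subtree at z. *)
split=> //; apply: (IH z [set s | H (z :: s)]).
  split=> //.
  - by move=> s /Hhat /hat_wScons[].
  - move=> s u /= Hu [v e]; apply: Hseg Hu _; exists v; by rewrite e.
  - move=> s [/= Hs nS]; have [|D' FD' e] := HW (z :: s).
      by split=> //= -[].
    exists D' => //; apply/seteqP; split=> u.
      move=> [x Dx <-]; split; last by exists x.
      by have [] : succs H (z :: s) (rcons (z :: s) x) by rewrite -e; exists x.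
    move=> [/= Hu [x eu]]; have : succs H (z :: s) (rcons (z :: s) x).
      by split; [rewrite rcons_cons -eu | exists x].
    by rewrite -e eu => -[y Dy /rcons_inj[<-]]; exists y.
by move=> s [/= Hs Ss]; apply: HA.
Qed.

Lemma W_tree_exists t A : wU t A ->
  exists2 H, W_tree (wS t) (wW t) H & H `&` wS t `<=` A.
Proof.
elim: t A => [|n c IH] A UA.
  exists [set [::]]; last by move=> s [-> _].
  split=> //; first by move=> s ->; exact: hat_wSnil.
    by move=> s u -> [[|] //]; case: s.
  by move=> s [->] /=.
(* The W-tree has [D] as first level, with a W-tree chosen by induction grafted at each of its
   points. *)
set D := [set z | B n z /\ wU (c z) [set s | A (z :: s)]] in UA.
have /choice[H HP] : forall z, exists H, D z ->
    W_tree (wS (c z)) (wW (c z)) H /\ H `&` wS (c z) `<=` [set s | A (z :: s)].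
  move=> z; have [[_ /IH[H HW HA]]|nD] := pselect (D z); last by exists set0.
  by exists H.
exists [set s | if s is z :: s' then D z /\ H z s' else True]; last first.
  by move=> [|z s] [] //= [Dz Hs] [_ Ss]; have [_] := HP z Dz; apply.
split=> //.
- move=> [|z s]; first by move=> _; exact: hat_wSnil.
  move=> [Dz Hs]; apply/hat_wScons; split; first by case: Dz.
  by have [[Hh _ _ _] _] := HP z Dz; apply: Hh.
- move=> [|z s] [|z' u] //; first by move=> _ [].
  move=> [Dz Hu] [v [e1 e2]]; subst z'; split=> //.
  by have [[_ _ Hseg _] _] := HP z Dz; apply: Hseg Hu _; exists v.
move=> [|z s] [].
  move=> _ _; exists D => //; apply/seteqP; split=> u.
    move=> [z Dz <-]; split; last by exists z.
    by split=> //; have [[_ H0 _ _] _] := HP z Dz.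
  by move=> [Hu [z e]]; rewrite e /= in Hu *; exists z => //; case: Hu.
move=> [Dz Hs] nS; have [[_ _ _ HW] _] := HP z Dz.
have [|D' FD' e] := HW s; first by split=> // Ss; apply: nS; split=> //; case: Dz.
exists D' => //; apply/seteqP; split=> u.
  move=> [x Dx <-]; split; last by exists x.
  by split=> //; have [] : succs (H z) s (rcons s x) by rewrite -e; exists x.
move=> [Hu [x eu]]; rewrite eu /= in Hu *; case: Hu => _ Hu.
have : succs (H z) s (rcons s x) by split=> //; exists x.
by rewrite -e => -[y Dy /rcons_inj[<-]]; exists y.
Qed.

Lemma W_tree_ultrafilterE t A :
  W_tree_ultrafilter (wS t) (wW t) A <-> A `<=` wS t /\ wU t A.
Proof.
split=> [[AS [H HW HA]]|[AS /W_tree_exists[H HW HA]]]; split=> //.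
  exact: W_tree_large HA.
by exists H.
Qed.

Lemma wW_ultrafilter_on t s :
  ultrafilter_on (rcons s @` B (wlabel t s)) (wW t s).
Proof.
set n := wlabel t s.
split=> [A [D /F_sub DB <-]|]; first exact: image_subset.
apply/ultraP.
suff -> : [set A | wW t s (A `&` rcons s @` B n)] =
    [set A | F n ((rcons s @^-1` A) `&` B n)].
  have [UT UI US U0 UC] := F_ultra n; split=> /=.
  - exact: UT.
  - by move=> A A' /UI /[apply].
  - by move=> A A' AA'; apply: US => z; apply: AA'.
  - exact: U0.
  - by move=> A /UC.
apply/seteqP; split=> A.
  move=> [D FD e]; rewrite /= (_ : _ `&` _ = D) //; apply/seteqP; split=> z.
    move=> [Az Bz]; have : (A `&` rcons s @` B n) (rcons s z) by split=> //; exists z.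
    by rewrite -e => -[y Dy /rcons_inj[<-]].
  move=> Dz; split; last exact: F_sub FD _ Dz.
  by have [] : (A `&` rcons s @` B n) (rcons s z) by rewrite -e; exists z.
move=> FA; exists (rcons s @^-1` A `&` B n) => //; apply/seteqP; split=> u.
  by move=> [z [Az Bz] <-]; split=> //; exists z.
by move=> [Au [z Bz e]]; exists z => //; split=> //; rewrite /preimage /= e.
Qed.

Lemma wS_countable t : (forall n, countable (B n)) -> countable (wS t).
Proof.
move=> cB; elim: t => [|n c IH]; first exact: countable1.
suff -> : wS (WNode n c) = \bigcup_(z in B n) ((cons z) @` wS (c z)).
  apply: bigcup_countable => // z _; apply: sub_countable (IH z); exact: card_image_le.
apply/seteqP; split=> s.
  by case: s => [|z s] //= [Bz Ss]; exists z => //; exists s.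
by move=> [z Bz [u Su <-]].
Qed.

End WellFoundedTrees.

(** * Y_n-limits of ultrafilters given by well-founded trees *)

Lemma Ybase_countable n : countable (Ybase n).
Proof.
rewrite YbaseE; apply: sub_countable (card_image_le _ _) _; exact: countableP.
Qed.

(** The number of leaves of any block in the base set gives the index; hence the uniqueness of the
    Y_n at each node. *)
Lemma Ybase_uniq n m : Ybase n = Ybase m -> n = m.
Proof.
rewrite !YbaseE => e; pose b : nblock := (n, iota 0 n).
have bn : is_nblock n b.
  rewrite /is_nblock iota_ltn_sorted size_iota eqxx; apply/allP => i.
  by rewrite mem_iota => /ltnW.
have : (blk @` [set b | is_nblock n b]) (blk b) by exists b.
rewrite e => -[c cm]; move/(nblock_inj cm bn) => eb.
by have /and3P[_ /eqP <- _] := bn; have /and3P[_ /eqP <- _] := cm; rewrite eb.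
Qed.

Lemma blk_dec : exists dec : set node -> nblock,
  forall n b, is_nblock n b -> dec (blk b) = b.
Proof.
have /choice[dec decP] : forall z, exists b : nblock,
    forall n c, is_nblock n c -> blk c = z -> c = b.
  move=> z; have [[n [b bn e]]|nz] := pselect (exists n, exists2 b, is_nblock n b & blk b = z).
    by exists b => m c cm; rewrite -e; apply: nblock_inj cm bn.
  by exists (0, [::]) => n c cn e; case: nz; exists n, c.
by exists dec => n b bn; rewrite -(decP _ n b).
Qed.

Section Representation.
Variables (U1 : set_system node) (U1_Ramsey : Ramsey_for_R1 U1).

Local Notation C := (U1 `&` R1).
Local Notation Y := (nY U1).
Local Notation treeS := (wS Ybase).
Local Notation treeU := (wU Ybase (Yult U1)).
Let Y_ultra := nY_ultra U1_Ramsey.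

Lemma Yult_sub n A : Yult U1 n A -> A `<=` Ybase n.
Proof. by case. Qed.

Lemma Yult_setI n A : Yult U1 n (A `&` Ybase n) <-> Y n (blk @^-1` A).
Proof.
rewrite YultE; split=> [[_]|YA].
  by apply: ultraS => // b [].
split=> // ; apply: ultraS (ultraI (Y_ultra n) YA (nY_is_nblock U1_Ramsey n)) => //.
by move=> b [Ab bn]; split=> //; rewrite YbaseE; exists b.
Qed.

Lemma Yult_ultra n : ultra [set A | Yult U1 n (A `&` Ybase n)].
Proof.
have -> : [set A | Yult U1 n (A `&` Ybase n)] = [set A | Y n (blk @^-1` A)].
  by apply/seteqP; split=> A /=; rewrite Yult_setI.
have [YT YI YS Y0 YC] := Y_ultra n; split=> //=.
- by move=> A B YA YB; apply: YI.
- by move=> A B AB; apply: YS => b; apply: AB.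
- by move=> A /YC.
Qed.

Lemma treeU_node n c A : treeU (WNode n c) A <->
  Y n [set b | treeU (c (blk b)) [set s | A (blk b :: s)]].
Proof.
rewrite -(Yult_setI n [set z | treeU (c z) [set s | A (z :: s)]]) /=.
by rewrite setIC.
Qed.

Lemma treeU_ultra t : ultra (treeU t).
Proof. by apply: wU_ultra; [exact: Yult_sub | exact: Yult_ultra]. Qed.

Variable (I : Type).
Implicit Types (v : nblock -> set_system I) (V : set_system I).

(** Injectivity on a large set only is easier to preserve under grafting than a bijection;
    [tree_rep_isomorphic] supplies the bijection at the end. *)
Definition tree_rep V := exists t (h : seq (set node) -> I),
  (exists2 A, treeU t A & forall s u, A s -> A u -> h s = h u -> s = u) /\
  V = [set B | treeU t (h @^-1` B)].

Definition Ylim n v : set_system I := [set B | Y n [set b | v b B]].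

Lemma principal_ultra (x : I) : ultra [set B : set I | B x].
Proof. by split=> //= A B; apply. Qed.

Lemma principal_tree_rep (x : I) : tree_rep [set B | B x].
Proof.
exists (WLeaf _), (fun=> x); split=> //=.
by exists [set [::]] => // s u -> ->.
Qed.

Lemma Ylim_ultra n v : Y n [set b | ultra (v b)] -> ultra (Ylim n v).
Proof.
move=> Yv; have [YT YI YS Y0 YC] := Y_ultra n; split=> /=.
- by apply: YS Yv => b [].
- move=> A B vA vB; apply: YS (YI _ _ Yv (YI _ _ vA vB)).
  by move=> b [ub [bA bB]]; apply: (ultraI ub).
- move=> A B AB vA; apply: YS (YI _ _ Yv vA).
  by move=> b [ub bA]; apply: (ultraS ub) bA.
- move=> v0; apply: Y0; apply: YS (YI _ _ Yv v0).
  by move=> b [ub b0]; apply: (ultra0 ub).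
- move=> A /YC vA; apply: YS (YI _ _ Yv vA).
  by move=> b [ub bA]; apply: (ultraC ub).
Qed.

(* Distinct ultrafilters, none of which is their limit, are separated by
   pairwise disjoint sets along the limit. *)
Lemma Ylim_discrete m v X : C X ->
  (forall b, blks m X b -> ultra (v b) /\ v b <> Ylim m v) ->
  (forall b c, blks m X b -> blks m X c -> v b = v c -> b = c) ->
  exists X' (A : nblock -> set I), [/\ C X', X' `<=` X,
    forall b, blks m X' b -> v b (A b) &
    forall b c x, blks m X' b -> blks m X' c -> A b x -> A c x -> b = c].
Proof.
move=> CX vX vinj; have [UX _] := CX.
have uV : ultra (Ylim m v).
  by apply: Ylim_ultra; exists X => // b /vX[].
have /choice[D0 D0P] : forall b, exists A, blks m X b -> v b A /\ ~ Ylim m v A.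
  move=> b; have [bX|nb] := pselect (blks m X b); last by exists set0.
  have [ub ne] := vX b bX; have [A vA nA] := ultra_sep ub uV ne.
  by exists A.
have /choice[D DP] : forall p : nblock * nblock, exists A,
    blks m X p.1 -> blks m X p.2 -> p.1 <> p.2 -> v p.1 A /\ ~ v p.2 A.
  move=> [b c] /=.
  have [[bX [cX ne]]|np] := pselect (blks m X b /\ blks m X c /\ b <> c); last first.
    by exists set0 => bX cX ne; case: np.
  have [|A vA nA] := ultra_sep (proj1 (vX b bX)) (proj1 (vX c cX)).
    by move=> /(vinj b c bX cX).
  by exists A.
(* [D0 b] is not in the limit, so it is outside [v c] for almost all c; diagonalizing, for all c of
   higher level than b. *)
have [|X1 [UX1 _] X1P] := @nY_diag _ U1_Ramsey m (fun b c => ~ v c (D0 b)).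
  exists X => // b bX /=; have [_ nV] := D0P b bX.
  exact: (ultraC (Y_ultra m)) nV.
have [X2 CX2 X2X] := C_dir U1_Ramsey UX UX1.
have toX b : blks m X2 b -> blks m X b by apply: blksS => s /X2X[].
have toX1 b : blks m X2 b -> blks m X1 b by apply: blksS => s /X2X[].
(* The set for b has to avoid only the finitely many c of level at most that of b: at lower levels
   by removing [D0 c], at its own level by a difference that makes the two sets disjoint. *)
pose N b c : set I := if b.1 == c.1 then D (b, c) `\` D (c, b) else ~` D0 c.
pose E b := [set c | [/\ blks m X2 c, c <> b & c.1 <= b.1]].
exists X2, (fun b => D0 b `&` \bigcap_(c in E b) N b c); split=> //.
- by move=> s /X2X[].
- move=> b bX2; have bX := toX b bX2; have [ub _] := vX b bX.
  have [vD _] := D0P b bX; apply: (ultraI ub) => //; apply: ultra_bigcap => //.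
    by apply: sub_finite_set (finite_nblocks m b.1) => c [[cm _] _ le].
  move=> c [cX2 cb le]; have cX := toX c cX2; rewrite /N; case: eqP => [_|/eqP ne].
    have [v1 _] := DP (b, c) bX cX (nesym cb); have [_ v2] := DP (c, b) cX bX cb.
    rewrite setDE; exact: (ultraI ub) (ultraC ub v2).
  apply: (ultraC ub); apply: X1P; [exact: toX1 | exact: toX1 |].
  by rewrite ltn_neqAle eq_sym ne.
move=> b c x bX2 cX2.
wlog le : b c bX2 cX2 / c.1 <= b.1.
  move=> W; case: (leqP c.1 b.1) => [le|/ltnW le] bx cx; first exact: W.
  exact/esym/W.
move=> [b0 bE] [c0 cE]; apply: contrapT => ne.
have := bE c (And3 cX2 (nesym ne) le); rewrite /N; case: eqP => [e|_]; last exact.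
have := cE b (And3 bX2 ne _); rewrite e => /(_ (leqnn _)).
by rewrite /N e eqxx => -[_ ?] [? _].
Qed.

(** The trees of the [v b] are grafted onto a root labelled m. Disjointness of the sets [A b]
    recovers the first entry from the value, so the combined map is injective on a large set. *)
Lemma Ylim_tree_rep_discrete m v X (A : nblock -> set I) (x0 : I) : C X ->
  (forall b, blks m X b -> v b (A b) /\ tree_rep (v b)) ->
  (forall b c x, blks m X b -> blks m X c -> A b x -> A c x -> b = c) ->
  tree_rep (Ylim m v).
Proof.
move=> CX vX Adisj; have [dec decP] := blk_dec.
have /choice[th thP] : forall b, exists th : wtree (set node) * (seq (set node) -> I),
    blks m X b -> (exists2 G, treeU th.1 G & forall s u, G s -> G u ->
      th.2 s = th.2 u -> s = u) /\ v b = [set B | treeU th.1 (th.2 @^-1` B)].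
  move=> b; have [bX|nb] := pselect (blks m X b); last by exists (WLeaf _, fun=> x0).
  by have [_ [t [h H]]] := vX b bX; exists (t, h).
have /choice[G GP] : forall b, exists G, blks m X b -> treeU (th b).1 G /\
    forall s u, G s -> G u -> (th b).2 s = (th b).2 u -> s = u.
  move=> b; have [bX|nb] := pselect (blks m X b); last by exists set0.
  by have [[G UG Gi] _] := thP b bX; exists G.
pose h (s : seq (set node)) := if s is z :: s' then (th (dec z)).2 s' else x0.
pose t := WNode m (fun z => (th (dec z)).1).
exists t, h; split.
  exists [set s | if s is z :: s' then exists2 b, blks m X b /\ z = blk b &
    G b s' /\ A b ((th b).2 s') else False].
    apply/treeU_node; exists X => // b bX; have [bm _] := bX.
    rewrite /= (decP _ _ bm); have [UG _] := GP b bX; have [vA _] := vX b bX.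
    have [_ ve] := thP b bX; rewrite ve /= in vA.
    apply: ultraS (ultraI (treeU_ultra _) UG vA); first exact: treeU_ultra.
    by move=> s [Gs As]; exists b.
  move=> [|z s] [|z' u] //= [b [bX ->] [Gb Ab]] [c [cX ->] [Gc Ac]].
  have [bm _] := bX; have [cm _] := cX; rewrite (decP _ _ bm) (decP _ _ cm) => e.
  have bc : b = c by apply: (Adisj b c ((th b).2 s)) => //; rewrite e.
  by subst c; congr cons; have [_] := GP b bX; apply.
apply/seteqP; split=> B.
  move=> [X' [UX' _] X'B]; apply: (proj2 (treeU_node m _ _)).
  have [Z CZ ZX] := C_dir U1_Ramsey UX' (proj1 CX); exists Z => // b bZ.
  have bX : blks m X b by apply: blksS bZ => s /ZX[].
  have : v b B by apply: X'B; apply: blksS bZ => s /ZX[].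
  have [bm _] := bX; rewrite /= (decP _ _ bm).
  by have [_ ->] := thP b bX.
move=> UB; have /treeU_node[X' [UX' _] X'B] : treeU t (h @^-1` B) := UB.
have [Z CZ ZX] := C_dir U1_Ramsey UX' (proj1 CX); exists Z => // b bZ.
have bX : blks m X b by apply: blksS bZ => s /ZX[].
have := X'B b; rewrite /=; have [bm _] := bX; rewrite (decP _ _ bm) => h'.
have [_ -> /=] := thP b bX; apply: h'; apply: blksS bZ => s /ZX[] //.
Qed.

(** In the nontrivial case [v] factors through [pr], which keeps the leaves at the positions in [J].
    As [pr] carries Y_n to Y_m, with m the number of these positions, the limit becomes a Y_m-limit
    of distinct ultrafilters. *)
Lemma Ylim_tree_rep n v (x0 : I) : Y n [set b | ultra (v b) /\ tree_rep (v b)] ->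
  tree_rep (Ylim n v).
Proof.
move=> [X0 CX0 X0v]; have [UX0 _] := CX0.
have [[b [bX e]]|nV] := pselect (exists b, blks n X0 b /\ v b = Ylim n v).
  by rewrite -e; have [] := X0v b bX.
have uV : ultra (Ylim n v) by apply: Ylim_ultra; exists X0 => // b /X0v[].
have [|J szJ [X1 [UX1 _] X1J]] := @nY_canonical _ U1_Ramsey n _ v.
  exists X0 => // b bX /=.
  (* If [v] took the value [v b] almost everywhere, [v b] would be the limit. *)
  suff : ~ Y n [set c | v b = v c] by move/(ultraC (Y_ultra n)).
  move=> Yb; apply: nV; exists b; split=> //.
  have [ub _] := X0v b bX; apply: ultra_max => // B vB.
  by apply: (ultraS (Y_ultra n) _ Yb) => c /= <-.
have [X [UX RX] XX] := C_dir U1_Ramsey UX0 UX1.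
have toX0 b : blks n X b -> blks n X0 b by apply: blksS => s /XX[].
have toX1 b : blks n X b -> blks n X1 b by apply: blksS => s /XX[].
pose m := count id J; pose pr (b : nblock) : nblock := (b.1, mask J b.2).
have prY B : Y m B -> Y n [set b | B (pr b)].
  by rewrite -szJ; apply: nY_mask.
have /choice[lift liftP] : forall c, exists b,
    (exists2 b', blks n X b' & pr b' = c) -> blks n X b /\ pr b = c.
  move=> c; have [[b bX e]|nc] := pselect (exists2 b, blks n X b & pr b = c).
    by exists b.
  by exists (0, [::]).
pose w c := v (lift c).
have wv b : blks n X b -> w (pr b) = v b.
  move=> bX; have [|lX el] := liftP (pr b); first by exists b.
  by apply/(X1J _ _ (toX1 _ lX) (toX1 _ bX)); case: el.
have Ywv : Ylim m w = Ylim n v.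
  apply/seteqP; split=> B /= YB.
    apply: (ultraS (Y_ultra n) _ (ultraI (Y_ultra n) (prY _ YB) (nY_blks U1_Ramsey n UX))).
    by move=> b [/= wB bX]; rewrite -wv.
  apply: contrapT => /(ultraC (Y_ultra m)) /prY nB.
  have := ultraI (Y_ultra n) YB (ultraI (Y_ultra n) nB (nY_blks U1_Ramsey n UX)).
  by move/(ultra_ex (Y_ultra n)) => [b [/= vB [/= nwB bX]]]; apply: nwB; rewrite wv.
have : Y m [set c | exists2 b, blks n X b & pr b = c].
  apply: contrapT => /(ultraC (Y_ultra m)) /prY nB.
  have := ultraI (Y_ultra n) nB (nY_blks U1_Ramsey n UX).
  by move/(ultra_ex (Y_ultra n)) => [b [/= nb bX]]; apply: nb; exists b.
move=> [X2 CX2 X2l].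
have lX c : blks m X2 c -> blks n X (lift c) /\ pr (lift c) = c.
  by move=> /X2l /liftP.
have [||X3 [A [CX3 X32 X3A Adisj]]] := @Ylim_discrete m w X2 CX2.
- move=> c /lX[lcX _]; have lc0 := toX0 _ lcX; split; first by case: (X0v _ lc0).
  by rewrite Ywv => e; apply: nV; exists (lift c).
- move=> b c /lX[bX eb] /lX[cX ec] e; rewrite -eb -ec.
  by have [/(_ e)[e1 e2] _] := X1J _ _ (toX1 _ bX) (toX1 _ cX); rewrite /pr e1 e2.
rewrite -Ywv; apply: Ylim_tree_rep_discrete x0 CX3 _ Adisj => c cX3.
split; first exact: X3A.
have [|lcX _] := lX c; first exact: blksS cX3.
by have [] := X0v _ (toX0 _ lcX).
Qed.

End Representation.

(** * Tukey maps as iterated limits *)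

(** The map is the union of [f] over smaller members of F. If no g X were inside A, the Z with f Z
    not inside A would form a base of F whose image is not a base of G. *)
Lemma tukey_monotone (T T' : Type) (F : set_system T) (G : set_system T') :
  ultra G -> tukey_le G F -> exists g : set T -> set T',
  [/\ forall X Z, X `<=` Z -> g X `<=` g Z,
      forall X, F X -> G (g X) &
      forall A, G A -> exists2 X, F X & g X `<=` A].
Proof.
move=> uG [f fP]; exists (fun X => \bigcup_(Z in [set Z | F Z /\ Z `<=` X]) f Z).
have Ff X : F X -> G (f X).
  move=> FX; have [|sub _] := fP F; first by split=> [//|A FA]; exists A.
  by apply: sub; exists X.
split.
- move=> X Z XZ s [W [FW WX] fs]; exists W => //; split=> //.
  exact: subset_trans XZ.
- by move=> X FX; apply: (ultraS uG) (Ff X FX) => s fs; exists X => //; split.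
move=> A GA; apply: contrapT => nX.
have [|_ /(_ A GA)[_ [Z [FZ nZ] <-] ZA]] := fP [set Z | F Z /\ ~ f Z `<=` A].
  split=> [Z []//|X FX]; apply: contrapT => nZ; apply: nX; exists X => //.
  move=> s [W [FW WX] fs]; apply: contrapT => nA; apply: nZ; exists W => //.
  by split=> // WA; apply/nA/WA.
exact: nZ.
Qed.

Section Fusion.
Variables (U1 : set_system node) (U1_Ramsey : Ramsey_for_R1 U1).

Local Notation C := (U1 `&` R1).
Local Notation Y := (nY U1).
Let Y_ultra := nY_ultra U1_Ramsey.

(** Up to each level k there are only finitely many relevant finite sequences of blocks, so a single
    [Z k] meets their demands; selectivity then puts later blocks into it. *)
Lemma C_fusion (G : seq nblock -> set nblock) :
  (forall l, Y (size l).+1 (G l)) ->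
  exists b X, [/\ C X, bpres b X & forall n, G (mkseq b n) (b n)].
Proof.
move=> YG.
(* Blocks of index up to n have at most n + 1 leaves, and the level k of the last one is at least n;
   hence the bound k + 1 on leaves and on length. *)
pose D0 k := \bigcup_(n in `I_k.+2) [set c | is_nblock n c /\ c.1 <= k].
have fD0 k : finite_set (D0 k).
  by apply: bigcup_finite; [exact: finite_II | move=> n _; exact: finite_nblocks].
have /choice[Z CZ] : forall k, exists Z, C Z /\ forall l, size l <= k.+1 ->
    (forall c, c \in l -> D0 k c) -> blks (size l).+1 Z `<=` G l.
  move=> k; have [||Z CZ ZG] := C_finite_dir U1_Ramsey (finite_seqs k.+1 (fD0 k))
      (Q := fun l Z => blks (size l).+1 Z `<=` G l).
  - by move=> l X Z XG ZX b bZ; apply: XG; apply: blksS bZ.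
  - by move=> l _; apply: YG.
  by exists Z; split=> // l szl lD; apply: ZG.
have [X [UX _] XP] := C_selective U1_Ramsey (fun k => proj1 (CZ k)).
(* The empty sequence has no last level and is handled by intersecting with one more set. *)
have [X0 [UX0 _] X0G] := YG [::].
have [X' [UX' RX'] X'X] := C_dir U1_Ramsey UX UX0.
have /R1P[b bX'] := RX'; have [bi bn _] := bX'.
have bb n : blks n.+1 X' (b n) by split=> //; apply: bpres_blk bX'.
exists b, X'; split=> // -[|n].
  by apply: X0G; apply: blksS (bb 0) => s /X'X[].
have [_ ZG] := CZ (b n).1; apply: ZG; rewrite ?size_mkseq.
- by rewrite ltnS; apply: inc_leq bi n.
- move=> c /mapP[i]; rewrite mem_iota /= add0n => lt ->; exists i.+1.
    by rewrite /= !ltnS; apply: leq_trans (inc_leq bi n).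
  split=> //; move: lt; rewrite ltnS leq_eqVlt => /orP[/eqP -> //|lt].
  exact/ltnW/bi.
apply: XP; last exact: bi.
- by have [] := X'X [:: (b n).1]; first by apply/(bpres_level _ bX'); exists n.
- by apply: blksS (bb n.+1) => s /X'X[].
Qed.

Variables (I : Type) (code : I -> nat) (g : set node -> set I).
Hypothesis code_inj : injective code.
Hypothesis g_mono : forall X Z, X `<=` Z -> g X `<=` g Z.
Hypothesis g_nonempty : forall X, U1 X -> exists x, g X x.

(* [a] stands for the union of the first [n] blocks of a member of R_1. *)
Inductive iterated_limit : nat -> set node -> set_system I -> Prop :=
| limit_principal n a x : (forall Z, U1 Z -> g (a `|` Z) x) ->
    iterated_limit n a [set B | B x]
| limit_Ylim n a v X : C X ->
    (forall b, blks n.+1 X b -> iterated_limit n.+1 (a `|` blk b) (v b)) ->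
    iterated_limit n a (Ylim U1 n.+1 v).

Lemma iterated_limit_tree_rep n a V (x0 : I) : iterated_limit n a V ->
  ultra V /\ tree_rep U1 V.
Proof.
elim=> {n a V} [n a x _|n a v X CX _ IH].
  by split; [exact: principal_ultra | exact: principal_tree_rep].
split; first by apply: Ylim_ultra => //; exists X => // b /IH[].
by apply: Ylim_tree_rep => //; exists X => // b /IH.
Qed.

(** Almost all blocks lie inside [Z], and adding such a block leaves the union of [a] and [Z]
    unchanged. *)
Lemma iterated_limit_sub n a V Z : iterated_limit n a V -> U1 Z -> V (g (a `|` Z)).
Proof.
move=> lV UZ; elim: lV => {n a V} [n a x gx|n a v X [UX _] _ IH]; first exact: gx.
have [X' CX' X'X] := C_dir U1_Ramsey UX UZ; exists X' => // b bX' /=.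
have := IH b; rewrite -setUA (_ : blk b `|` Z = Z); first by apply; apply: blksS bX' => s /X'X[].
by apply/setUidPr; have [_ bX] := bX' => s /bX /X'X[].
Qed.

(* Otherwise a fusion gives X in C none of whose approximations carries an
   iterated limit; then no x can belong to g X, since every x is excluded by
   some approximation of X together with a set containing the rest of X. *)
Lemma iterated_limit_exists : exists V, iterated_limit 0 set0 V.
Proof.
apply: contrapT => nV.
pose bad n a := forall V, ~ iterated_limit n a V.
pose acc (l : seq nblock) : set node := [set s | exists2 b, b \in l & blk b s].
(* At length n the point with code n, if any, is excluded: since no principal ultrafilter is
   attached to a bad [acc l], some Z keeps that point out. *)
have /choice[Zf ZfP] : forall l, exists Z, U1 Z /\ (bad (size l) (acc l) ->
    forall x, code x = size l -> ~ g (acc l `|` Z) x).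
  move=> l; have [X0 [UX0 _]] := C_ex U1_Ramsey.
  have [[x cx]|nx] := pselect (exists x, code x = size l); last first.
    by exists X0; split=> // _ x cx; case: nx; exists x.
  have [b|nb] := pselect (bad (size l) (acc l)); last by exists X0.
  have [Z UZ nZ] : exists2 Z, U1 Z & ~ g (acc l `|` Z) x.
    apply: contrapT => nZ; apply: (b [set B | B x]); apply: limit_principal => Z UZ.
    by apply: contrapT => ng; apply: nZ; exists Z.
  exists Z; split=> // _ y cy; suff -> : y = x by [].
  by apply: code_inj; rewrite cy.
(* The next block must preserve badness and lie in every [Zf] promised at an earlier stage or at
   this one. *)
pose G l := [set b | bad (size l) (acc l) -> bad (size l).+1 (acc l `|` blk b)] `&`
  \bigcap_(m in `I_(size l).+1) blks (size l).+1 (Zf (take m l)).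
have [|b [X [CX bX bG]]] := @C_fusion G.
  move=> l; apply: (ultraI (Y_ultra _)); last first.
    apply: ultra_bigcap; [exact: Y_ultra | exact: finite_II |].
    by move=> m _; apply: nY_blks => //; case: (ZfP (take m l)).
  have [bl|nb] := pselect (bad (size l) (acc l)); last first.
    by apply: (ultraS (Y_ultra _) _ (ultraT (Y_ultra _))) => b _ /= /nb.
  apply: contrapT => /(ultraC (Y_ultra _))[X CX XP].
  have /choice[v vP] : forall b, exists V, blks (size l).+1 X b ->
      iterated_limit (size l).+1 (acc l `|` blk b) V.
    move=> b; have [bX|nbX] := pselect (blks (size l).+1 X b); last by exists set0.
    have [V lV] : exists V, iterated_limit (size l).+1 (acc l `|` blk b) V.
      apply: contrapT => nl; apply: (XP b bX) => _ V lV; apply: nl; by exists V.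
    by exists V.
  (* If almost all extensions carried iterated limits, their Y-limit would be attached to [acc l]
     itself. *)
  by apply: (bl (Ylim U1 (size l).+1 v)); apply: limit_Ylim vP.
have badn n : bad n (acc (mkseq b n)).
  elim: n => [|n IH].
    move=> V lV; apply: nV; exists V; rewrite (_ : set0 = acc (mkseq b 0)) //.
    by apply/seteqP; split=> s // [].
  have [/= h _] := bG n; rewrite size_mkseq in h.
  rewrite (_ : acc _ = acc (mkseq b n) `|` blk (b n)); first exact: h.
  apply/seteqP; split=> s.
    move=> [c]; rewrite mkseqS mem_rcons inE => /orP[/eqP -> cs|cl cs]; first by right.
    by left; exists c.
  by move=> [[c cl cs]|bs]; [exists c | exists (b n)] => //;
    rewrite mkseqS mem_rcons inE ?cl ?eqxx ?orbT.
have [x gx] := g_nonempty (proj1 CX).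
pose m := code x; have [_ h] := ZfP (mkseq b m); rewrite size_mkseq in h.
apply: (h (badn m) x erefl).
apply: g_mono gx; have [_ _ ->] := bX => s [i _ bs].
(* Blocks before stage [m] belong to the approximation; all later ones were kept inside its [Zf]. *)
have [im|mi] := ltnP i m.
  by left; exists (b i) => //; apply/mapP; exists i => //; rewrite mem_iota.
right; have [_ /(_ m)] := bG i; rewrite size_mkseq => /(_ mi)[_].
by rewrite -map_take take_iota (minn_idPl mi); apply.
Qed.

End Fusion.

(** * From injectivity on a large set to an isomorphism *)

Lemma ultra_finite (T : Type) (F : set_system T) A : ultra F -> finite_set A ->
  F A -> exists x, F [set x].
Proof.
move=> uF fA FA; apply: contrapT => nx.
have := @ultra_bigcap T {classic T} F A (fun x => ~` [set x]) uF fA.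
move=> /(_ _) H; apply: (ultra0 uF); apply: (ultraS uF) (ultraI uF FA (H _)).
  by move=> x [Ax /(_ x Ax)] /=.
by move=> x Ax; apply: (ultraC uF) => Fx; apply: nx; exists x.
Qed.

Lemma infinite_range (T : Type) (e : nat -> T) : injective e -> infinite_set (range e).
Proof.
move=> ei; rewrite (eq_finite_set (inj_card_eq _)); first exact: infinite_nat.
by move=> x y _ _; apply: ei.
Qed.

Lemma infinite_split (T : Type) (A : set T) : infinite_set A ->
  exists2 D, D `<=` A & infinite_set D /\ infinite_set (A `\` D).
Proof.
elim/Ppointed: T => T in A *; first by rewrite emptyE => /(_ (finite_set0 _)).
move=> /infiniteP /pcard_leP[e].
have ei : injective e by move=> i j; apply: 'inj_e; rewrite inE.
have eA i : A (e i) by apply: 'funS_e.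
exists (range (fun i => e i.*2)); first by move=> _ [i _ <-].
split; first by apply: infinite_range => i j /ei /double_inj.
apply: sub_infinite_set (@infinite_range _ (fun i => e i.*2.+1) _); last first.
  by move=> i j /ei [] /double_inj.
move=> _ [i _ <-]; split=> // -[j _ /ei /(congr1 odd)].
by rewrite /= !odd_double.
Qed.

(** On a large set with infinite complement, [h] is injective and both complements are countably
    infinite, so it extends to a bijection; altering it off a large set does not change the image
    ultrafilter. *)
Lemma tree_rep_isomorphic (U1 : set_system node) (I : Type) (V : set_system I) t h :
  Ramsey_for_R1 U1 -> countable [set: I] -> ultra V -> nonprincipal V ->
  (exists2 A, wU Ybase (Yult U1) t A & forall s u, A s -> A u -> h s = h u -> s = u) ->
  V = [set B | wU Ybase (Yult U1) t (h @^-1` B)] ->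
  isomorphic [set: I] V (wS Ybase t)
    (W_tree_ultrafilter (wS Ybase t) (wW (Yult U1) t)).
Proof.
move=> U1_Ramsey cI uV npV [A0 UA0 A0i] VE.
set S := wS Ybase t; set U := wU Ybase (Yult U1) t in UA0 VE.
have uU : ultra U by apply: treeU_ultra.
have US : U S by apply: wU_wS; [exact: Yult_sub | exact: Yult_ultra].
have cS : countable S by apply: wS_countable; exact: Ybase_countable.
pose A := A0 `&` S; have UA : U A by apply: (ultraI uU).
(* A finite member would make the tree ultrafilter, and then [V], principal. *)
have iA : infinite_set A.
  move=> /(ultra_finite uU) /(_ UA)[s Us]; apply: (npV (h s)); rewrite VE.
  by apply: (ultraS uU) Us => _ ->.
have [D [DA UD iAD]] : exists D, [/\ D `<=` A, U D & infinite_set (A `\` D)].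
  have [D DA [iD iAD]] := infinite_split iA.
  have [UD|/(ultraC uU) nD] := pselect (U D); first by exists D.
  exists (A `\` D); split; first by move=> s [].
    by rewrite setDE; apply: (ultraI uU).
  by rewrite setDD setIidr.
have hi : {in D &, injective h}.
  by move=> s u; rewrite !inE => /DA[As _] /DA[Au _]; apply: A0i.
have hAi : {in A &, injective h}.
  by move=> s u; rewrite !inE => -[As _] [Au _]; apply: A0i.
have DS : D `<=` S by move=> s /DA[].
have e1 : (S `\` D #= [set: nat])%card.
  apply: eq_card_nat.
    by apply: sub_countable cS; apply: subset_card_le => s [].
  by apply: sub_infinite_set iAD => s [[_ Ss] nD].
have e2 : ([set: I] `\` h @` D #= [set: nat])%card.
  apply: eq_card_nat.
    by apply: sub_countable cI; apply: subset_card_le.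
  have iH : infinite_set (h @` (A `\` D)).
    rewrite (eq_finite_set (inj_card_eq _)) //.
    by move=> s u; rewrite !inE => -[As _] [Au _]; apply: hAi; rewrite inE.
  apply: sub_infinite_set iH => _ [s [As nD] <-]; split=> // -[u Du e].
  by apply: nD; rewrite (hAi s u) // ?inE //; apply: DA.
have [f fE] := Pbij (inj_bij hi).
have [g gf] := super_bij f DS (@subsetT _ (h @` D)) (card_eq_trans e1 (card_esym e2)).
have gh s : D s -> g s = h s by move=> Ds; rewrite gf -?fE ?inE.
have [_ gi gs] := @bij _ _ _ _ g.
have /choice[k kP] : forall x, exists s, S s /\ g s = x.
  by move=> x; have [s Ss e] := gs x Logic.I; exists s.
have kS x : S (k x) by case: (kP x).
have gk x : g (k x) = x by case: (kP x).
have kg s : S s -> k (g s) = s by move=> Ss; apply: gi; rewrite ?inE.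
exists k; first split.
- by move=> x _.
- by move=> x y _ _ e; rewrite -(gk x) e gk.
- by move=> s Ss; exists (g s) => //; apply: kg.
move=> B _; rewrite W_tree_ultrafilterE; [|exact: Yult_sub|exact: Yult_ultra].
have agree s : D s -> (h @^-1` B) s <-> (k @` B) s.
  move=> Ds; rewrite /preimage /= -gh //; split=> [Bg|[x Bx <-]]; last by rewrite gk.
  by exists (g s) => //; apply: kg; apply: DS.
rewrite VE; split=> [UB|[_ UB]].
  split; first by move=> _ [x _ <-]; apply: kS.
  by apply: (ultraS uU) (ultraI uU UD UB) => s [Ds Bs]; apply/(agree s Ds).
by apply: (ultraS uU) (ultraI uU UD UB) => s [Ds Bs]; apply/(agree s Ds).
Qed.

Theorem theorem5p10 (U1 : set_system node) (I : Type) (V : set_system I)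
    (U1_Ramsey : Ramsey_for_R1 U1) (U1_canonization : canonization U1)
    (I_countable : countable [set: I])
    (V_ultra : UltraFilter V) (V_nonprincipal : nonprincipal V)
    (V_le_U1 : tukey_le V U1) :
  exists (S : set (seq (set node)))
         (W : seq (set node) -> set_system (seq (set node))),
    [/\ countable S,
        prefix_free S,
        no_infinite_branch (hat S),
        (forall s, (hat S `\` S) s ->
           ultrafilter_on (succs (hat S) s) (W s) /\
           exists! n, copy_of_Y U1 n S s (W s))
      & isomorphic [set: I] V S (W_tree_ultrafilter S W)].
Proof.
have uV : ultra V by apply/ultraP.
have [x0 _] := ultra_ex uV (ultraT uV).
have [g [g_mono gV g_cof]] := tukey_monotone uV V_le_U1.
have /countable_injP[code code_inj] := I_countable.
have [||V' limV'] := @iterated_limit_exists _ U1_Ramsey I code g _ g_mono.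
- by move=> x y; apply: code_inj; rewrite inE.
- by move=> X /gV; apply: ultra_ex.
have [uV' repV'] := iterated_limit_tree_rep U1_Ramsey x0 limV'.
(* The sets g X are cofinal in [V] and all belong to [V'], so [V] is included in [V'], and
   ultrafilters are maximal. *)
have VV' : V = V'.
  apply: ultra_max => // A /g_cof[X UX XA].
  apply: (ultraS uV') XA _; rewrite -(set0U X).
  exact: iterated_limit_sub limV' UX.
have [t [h [hi V'E]]] := repV'; rewrite -VV' in V'E.
have Ysub := @Yult_sub U1; have Yu := Yult_ultra U1_Ramsey.
exists (wS Ybase t), (wW (Yult U1) t); split.
- exact: wS_countable Ybase_countable.
- exact: wS_prefix_free.
- exact: wS_wf.
- move=> s /(succs_wS Ysub Yu) sE; split; first by rewrite sE; apply: wW_ultrafilter_on.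
  exists (wlabel t s); split; first by split.
  (* The set of successors alone determines the index. *)
  move=> n [e _]; apply: Ybase_uniq.
  apply/seteqP; split=> z Bz.
    have : (rcons s @` Ybase n) (rcons s z) by rewrite -e sE; exists z.
    by move=> [y By /rcons_inj[<-]].
  have : succs (hat (wS Ybase t)) s (rcons s z) by rewrite e; exists z.
  by rewrite sE => -[y By /rcons_inj[<-]].
exact: tree_rep_isomorphic hi V'E.
Qed.
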